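(* Every strongly regular minimal surface of general type in $\mathbb R^4$ locally admits canonical parameters, i.e. semi-canonical parameters $(u,v)$ with $$E=G=\frac{1}{\sqrt{|\mu^2-\nu^2|}},\qquad F=0 .$$
   Context: $\mathbb R^4$ carries the standard metric $g=\langle\cdot,\cdot\rangle$ and flat connection $\nabla'$; everything is smooth and local. For a regular surface $M^2: z=z(u,v)$ let $E,F,G$ be the first fundamental form coefficients, $\sigma$ the second fundamental form, $K$ the Gauss curvature, and $\varkappa$ the curvature of the normal connection, $\varkappa=g(R^\perp(x,y)n_2,n_1)$ for a positively oriented orthonormal frame $(x,y,n_1,n_2)$ with $x,y$ tangent. Minimal means $\sigma(x,x)+\sigma(y,y)=0$ for orthonormal tangent $x,y$. A minimal surface is of general type if $K^2-\varkappa^2>0$ and $\varkappa\neq0$ everywhere. The ellipse of curvature at $p$ is $\{\sigma(v,v): v\in T_pM^2,\ |v|=1\}$; a tangent line is canonical if it is collinear with an axis of this ellipse. The geometric frame is a positively oriented orthonormal frame $\{x,y,n_1,n_2\}$ with $x,y$ canonical tangent fields and $n_1,n_2$ normal, satisfying $\nabla'_xx=\gamma_1y+\nu n_1$, $\nabla'_xy=-\gamma_1x+\mu n_2$, $\nabla'_yx=-\gamma_2y+\mu n_2$, $\nabla'_yy=\gamma_2x-\nu n_1$, $\nabla'_xn_1=-\nu x+\beta_1n_2$, $\nabla'_yn_1=\nu y+\beta_2n_2$, $\nabla'_xn_2=-\mu y-\beta_1n_1$, $\nabla'_yn_2=-\mu x-\beta_2n_1$, with $\mu>0$, $\nu\ne0$,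 $\mu^2\ne\nu^2$; the functions $\nu,\mu,\gamma_1,\gamma_2,\beta_1,\beta_2$ are the invariants of $M^2$. Parameters $(u,v)$ are semi-canonical if the parametric lines are integral curves of the canonical tangents, with $F=0$, $x=z_u/\sqrt E$, $y=z_v/\sqrt G$; then $\gamma_1=-y(\ln\sqrt E)$, $\gamma_2=-x(\ln\sqrt G)$. A minimal surface of general type is strongly regular if $\gamma_1\gamma_2\neq0$ everywhere. *)

(* Defs.v *)
From Stdlib Require Import Reals Lra ClassicalEpsilon.
Open Scope R_scope.

Record R4 : Type := mkR4 { c1 : R; c2 : R; c3 : R; c4 : R }.

Definition vadd (a b : R4) : R4 :=
  mkR4 (c1 a + c1 b) (c2 a + c2 b) (c3 a + c3 b) (c4 a + c4 b).
Definition vscal (r : R) (a : R4) : R4 :=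
  mkR4 (r * c1 a) (r * c2 a) (r * c3 a) (r * c4 a).
Definition vsub (a b : R4) : R4 := vadd a (vscal (-1) b).
Definition vzero : R4 := mkR4 0 0 0 0.
Definition dot (a b : R4) : R :=
  c1 a * c1 b + c2 a * c2 b + c3 a * c3 b + c4 a * c4 b.

Definition det3 (a1 a2 a3 b1 b2 b3 d1 d2 d3 : R) : R :=
  a1 * (b2 * d3 - b3 * d2) - a2 * (b1 * d3 - b3 * d1) + a3 * (b1 * d2 - b2 * d1).
Definition det4 (a b c d : R4) : R :=
    c1 a * det3 (c2 b) (c3 b) (c4 b) (c2 c) (c3 c) (c4 c) (c2 d) (c3 d) (c4 d)
  - c2 a * det3 (c1 b) (c3 b) (c4 b) (c1 c) (c3 c) (c4 c) (c1 d) (c3 d) (c4 d)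
  + c3 a * det3 (c1 b) (c2 b) (c4 b) (c1 c) (c2 c) (c4 c) (c1 d) (c2 d) (c4 d)
  - c4 a * det3 (c1 b) (c2 b) (c3 b) (c1 c) (c2 c) (c3 c) (c1 d) (c2 d) (c3 d).

Definition pos_orthonormal (a b c d : R4) : Prop :=
  dot a a = 1 /\ dot b b = 1 /\ dot c c = 1 /\ dot d d = 1 /\
  dot a b = 0 /\ dot a c = 0 /\ dot a d = 0 /\
  dot b c = 0 /\ dot b d = 0 /\ dot c d = 0 /\
  det4 a b c d > 0.

Definition open2 (U : R -> R -> Prop) : Prop :=
  forall u v, U u v -> exists d, d > 0 /\
    forall u' v', Rabs (u' - u) < d -> Rabs (v' - v) < d -> U u' v'.

(* partial derivatives (value of the derivative whenever it exists) *)
Definition pd_u (f : R -> R -> R) (u v : R) : R :=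
  epsilon (inhabits 0) (fun l => derivable_pt_lim (fun s => f s v) u l).
Definition pd_v (f : R -> R -> R) (u v : R) : R :=
  epsilon (inhabits 0) (fun l => derivable_pt_lim (fun t => f u t) v l).

Definition has_pd_u (f : R -> R -> R) (U : R -> R -> Prop) : Prop :=
  forall u v, U u v -> exists l, derivable_pt_lim (fun s => f s v) u l.
Definition has_pd_v (f : R -> R -> R) (U : R -> R -> Prop) : Prop :=
  forall u v, U u v -> exists l, derivable_pt_lim (fun t => f u t) v l.

Definition cont2 (f : R -> R -> R) (U : R -> R -> Prop) : Prop :=
  forall u v, U u v -> forall eps, eps > 0 -> exists d, d > 0 /\
    forall u' v', U u' v' -> Rabs (u' - u) < d -> Rabs (v' - v) < d ->
      Rabs (f u' v' - f u v) < eps.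

Fixpoint Ck (k : nat) (f : R -> R -> R) (U : R -> R -> Prop) : Prop :=
  match k with
  | O => cont2 f U
  | S k' => cont2 f U /\ has_pd_u f U /\ has_pd_v f U /\
            Ck k' (pd_u f) U /\ Ck k' (pd_v f) U
  end.

Definition smooth (f : R -> R -> R) (U : R -> R -> Prop) : Prop :=
  forall k, Ck k f U.

Definition vsmooth (X : R -> R -> R4) (U : R -> R -> Prop) : Prop :=
  smooth (fun u v => c1 (X u v)) U /\ smooth (fun u v => c2 (X u v)) U /\
  smooth (fun u v => c3 (X u v)) U /\ smooth (fun u v => c4 (X u v)) U.

Definition vpd_u (X : R -> R -> R4) (u v : R) : R4 :=
  mkR4 (pd_u (fun a b => c1 (X a b)) u v) (pd_u (fun a b => c2 (X a b)) u v)
       (pd_u (fun a b => c3 (X a b)) u v) (pd_u (fun a b => c4 (X a b)) u v).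
Definition vpd_v (X : R -> R -> R4) (u v : R) : R4 :=
  mkR4 (pd_v (fun a b => c1 (X a b)) u v) (pd_v (fun a b => c2 (X a b)) u v)
       (pd_v (fun a b => c3 (X a b)) u v) (pd_v (fun a b => c4 (X a b)) u v).

Section Surf.
Variable z : R -> R -> R4.

Definition zu := vpd_u z.
Definition zv := vpd_v z.
Definition zuu := vpd_u zu.
Definition zuv := vpd_v zu.
Definition zvv := vpd_v zv.

Definition EE (u v : R) : R := dot (zu u v) (zu u v).
Definition FF (u v : R) : R := dot (zu u v) (zv u v).
Definition GG (u v : R) : R := dot (zv u v) (zv u v).
Definition WW (u v : R) : R := EE u v * GG u v - FF u v ^ 2.

(* coordinates of the tangential part of w in the basis z_u, z_v *)
Definition tc1 (u v : R) (w : R4) : R :=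
  (GG u v * dot w (zu u v) - FF u v * dot w (zv u v)) / WW u v.
Definition tc2 (u v : R) (w : R4) : R :=
  (EE u v * dot w (zv u v) - FF u v * dot w (zu u v)) / WW u v.
Definition tproj (u v : R) (w : R4) : R4 :=
  vadd (vscal (tc1 u v w) (zu u v)) (vscal (tc2 u v w) (zv u v)).
Definition nproj (u v : R) (w : R4) : R4 := vsub w (tproj u v w).

Definition is_tangent (u v : R) (w : R4) : Prop :=
  exists a b, w = vadd (vscal a (zu u v)) (vscal b (zv u v)).
Definition is_normal (u v : R) (w : R4) : Prop :=
  dot w (zu u v) = 0 /\ dot w (zv u v) = 0.

Definition Dflat (X Y : R -> R -> R4) (u v : R) : R4 :=
  vadd (vscal (tc1 u v (X u v)) (vpd_u Y u v)) (vscal (tc2 u v (X u v)) (vpd_v Y u v)).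

Definition sigma (u v : R) (p q : R4) : R4 :=
  let a1 := tc1 u v p in let b1 := tc2 u v p in
  let a2 := tc1 u v q in let b2 := tc2 u v q in
  nproj u v (vadd (vscal (a1 * a2) (zuu u v))
            (vadd (vscal (a1 * b2 + b1 * a2) (zuv u v)) (vscal (b1 * b2) (zvv u v)))).

(* mean curvature vector = centre of the ellipse of curvature (half the trace of sigma) *)
Definition Hvec (u v : R) : R4 :=
  vscal (/ (2 * WW u v))
    (vadd (vscal (GG u v) (nproj u v (zuu u v)))
      (vadd (vscal (-2 * FF u v) (nproj u v (zuv u v)))
            (vscal (EE u v) (nproj u v (zvv u v))))).

Definition in_ellipse (u v : R) (q : R4) : Prop :=
  exists w, is_tangent u v w /\ dot w w = 1 /\ q = sigma u v w w.

(* d spans an axis of the ellipse: d = q - centre with q a point of the ellipse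
   at maximal or minimal distance from the centre *)
Definition axis_dir (u v : R) (d : R4) : Prop :=
  exists q, in_ellipse u v q /\ d = vsub q (Hvec u v) /\
    ((forall q', in_ellipse u v q' ->
        dot (vsub q' (Hvec u v)) (vsub q' (Hvec u v)) <= dot d d) \/
     (forall q', in_ellipse u v q' ->
        dot d d <= dot (vsub q' (Hvec u v)) (vsub q' (Hvec u v)))).

Definition canonical_tangent (u v : R) (w : R4) : Prop :=
  is_tangent u v w /\ dot w w = 1 /\
  exists d lam, axis_dir u v d /\ vsub (sigma u v w w) (Hvec u v) = vscal lam d.

Definition minimal (U : R -> R -> Prop) : Prop :=
  forall u v, U u v -> forall x y,
    is_tangent u v x -> is_tangent u v y ->
    dot x x = 1 -> dot y y = 1 -> dot x y = 0 ->
    vadd (sigma u v x x) (sigma u v y y) = vzero.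

(* Gauss curvature K = g(R(d_u,d_v)d_v, d_u)/(EG-F^2) for the induced
   (Levi-Civita) connection nabla = tangential part of nabla' *)
Definition gaussK (u v : R) : R :=
  (dot (vpd_u (fun a b => tproj a b (zvv a b)) u v) (zu u v)
   - dot (vpd_v (fun a b => tproj a b (zuv a b)) u v) (zu u v)) / WW u v.

(* g(R^perp(x,y) n2, n1) for tangent vectors x, y at (u,v) and normal fields n1, n2,
   where D = normal part of nabla' and R^perp(d_u,d_v) = D_u D_v - D_v D_u *)
Definition normal_curv (u v : R) (x y : R4) (n1 n2 : R -> R -> R4) : R :=
  (tc1 u v x * tc2 u v y - tc1 u v y * tc2 u v x) *
  dot (vsub (nproj u v (vpd_u (fun a b => nproj a b (vpd_v n2 a b)) u v))
            (nproj u v (vpd_v (fun a b => nproj a b (vpd_u n2 a b)) u v)))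
      (n1 u v).

(* general type: K^2 - kappa^2 > 0 and kappa <> 0, kappa computed with any
   positively oriented orthonormal frame (x,y,n1,n2), x,y tangent, n1,n2 smooth
   normal fields near the point *)
Definition general_type (U : R -> R -> Prop) : Prop :=
  forall u v, U u v ->
  forall (V : R -> R -> Prop) (n1 n2 : R -> R -> R4) (x y : R4),
    open2 V -> V u v -> (forall a b, V a b -> U a b) ->
    vsmooth n1 V -> vsmooth n2 V ->
    (forall a b, V a b -> is_normal a b (n1 a b) /\ is_normal a b (n2 a b) /\
        dot (n1 a b) (n1 a b) = 1 /\ dot (n2 a b) (n2 a b) = 1 /\
        dot (n1 a b) (n2 a b) = 0) ->
    is_tangent u v x -> is_tangent u v y ->
    pos_orthonormal x y (n1 u v) (n2 u v) ->
    gaussK u v ^ 2 - normal_curv u v x y n1 n2 ^ 2 > 0 /\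
    normal_curv u v x y n1 n2 <> 0.

Definition regular_surface (U : R -> R -> Prop) : Prop :=
  open2 U /\ vsmooth z U /\ (forall u v, U u v -> WW u v > 0).

Definition geometric_frame (U : R -> R -> Prop) (x y n1 n2 : R -> R -> R4)
    (nu mu g1 g2 b1 b2 : R -> R -> R) : Prop :=
  vsmooth x U /\ vsmooth y U /\ vsmooth n1 U /\ vsmooth n2 U /\
  smooth nu U /\ smooth mu U /\ smooth g1 U /\ smooth g2 U /\
  smooth b1 U /\ smooth b2 U /\
  forall u v, U u v ->
    pos_orthonormal (x u v) (y u v) (n1 u v) (n2 u v) /\
    canonical_tangent u v (x u v) /\ canonical_tangent u v (y u v) /\
    is_normal u v (n1 u v) /\ is_normal u v (n2 u v) /\
    Dflat x x u v = vadd (vscal (g1 u v) (y u v)) (vscal (nu u v) (n1 u v)) /\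
    Dflat x y u v = vadd (vscal (- g1 u v) (x u v)) (vscal (mu u v) (n2 u v)) /\
    Dflat y x u v = vadd (vscal (- g2 u v) (y u v)) (vscal (mu u v) (n2 u v)) /\
    Dflat y y u v = vadd (vscal (g2 u v) (x u v)) (vscal (- nu u v) (n1 u v)) /\
    Dflat x n1 u v = vadd (vscal (- nu u v) (x u v)) (vscal (b1 u v) (n2 u v)) /\
    Dflat y n1 u v = vadd (vscal (nu u v) (y u v)) (vscal (b2 u v) (n2 u v)) /\
    Dflat x n2 u v = vadd (vscal (- mu u v) (y u v)) (vscal (- b1 u v) (n1 u v)) /\
    Dflat y n2 u v = vadd (vscal (- mu u v) (x u v)) (vscal (- b2 u v) (n1 u v)) /\
    mu u v > 0 /\ nu u v <> 0 /\ mu u v ^ 2 <> nu u v ^ 2.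

End Surf.

Definition strongly_regular (U : R -> R -> Prop) (g1 g2 : R -> R -> R) : Prop :=
  forall u v, U u v -> g1 u v * g2 u v <> 0.

Definition local_reparam (U : R -> R -> Prop) (u0 v0 : R)
    (V : R -> R -> Prop) (p1 p2 : R -> R -> R) : Prop :=
  open2 V /\ smooth p1 V /\ smooth p2 V /\
  (forall s t, V s t -> U (p1 s t) (p2 s t)) /\
  (forall s t s' t', V s t -> V s' t' ->
      p1 s t = p1 s' t' -> p2 s t = p2 s' t' -> s = s' /\ t = t') /\
  (forall s t, V s t ->
      pd_u p1 s t * pd_v p2 s t - pd_v p1 s t * pd_u p2 s t <> 0) /\
  (exists s0 t0, V s0 t0 /\ p1 s0 t0 = u0 /\ p2 s0 t0 = v0).

Definition reparam (z : R -> R -> R4) (p1 p2 : R -> R -> R) : R -> R -> R4 :=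
  fun s t => z (p1 s t) (p2 s t).

Definition semi_canonical (z : R -> R -> R4) (V : R -> R -> Prop)
    (p1 p2 : R -> R -> R) (x y : R -> R -> R4) : Prop :=
  let w := reparam z p1 p2 in
  forall s t, V s t ->
    FF w s t = 0 /\
    x (p1 s t) (p2 s t) = vscal (/ sqrt (EE w s t)) (zu w s t) /\
    y (p1 s t) (p2 s t) = vscal (/ sqrt (GG w s t)) (zv w s t).

(* Main.v *)
(* The Codazzi equations of the geometric frame give [x(L) = 4 gamma_2 L] and
   [y(L) = 4 gamma_1 L] for [L = mu^2 - nu^2].  Together with
   [d omega_1 (x, y) = gamma_1] and [d omega_2 (x, y) = - gamma_2] for the dual
   coframe of [x], [y], this says exactly that the forms [|L|^(1/4) omega_i] are
   closed.  Their local potentials are the canonical parameters: the coordinate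
   fields in these parameters are [x / |L|^(1/4)] and [y / |L|^(1/4)]. *)

Require Import Defs.
From Stdlib Require Import Reals Lra ClassicalEpsilon.
From Coquelicot Require Import Coquelicot.
(* Imported again because [c1] is shadowed by a projection of [C1_fun]. *)
Import Defs.
Open Scope R_scope.

(** * Calculus of [Ck] functions on open sets *)

(** The fields [x] and [y] do not commute, so their flows do not directly yield parameters.
    Rescaling them into coordinate fields amounts to making a multiple of the dual coframe exact,
    and the argument is therefore phrased with 1-forms in the given coordinates. Suitable pairings
    of the differential of one frame field with another frame field equal [nu] or [mu] times a
    coframe form; their exterior derivatives are the Codazzi equations. Taken separately, the
    equations for [nu] and [mu] contain [b1] and [b2], with the coefficients [mu] and [nu]
    exchanged. Only in [mu dmu - nu dnu] do these terms cancel, which is why the weight is a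
    function of [mu^2 - nu^2]. The factor 4 that remains fixes the exponent 1/4, and coordinate
    fields of length [|L|^(-1/4)] give [E = G = |L|^(-1/2)]. The potentials and the local inverse
    are first obtained with first-order information only; full smoothness of the inverse follows
    because its differential is a smooth function of its own values. *)

Lemma open2_locally (U : R -> R -> Prop) u v :
  open2 U -> U u v -> locally_2d U u v.
Proof.
  intros HU Huv. destruct (HU u v Huv) as [d [Hd H]].
  exists (mkposreal d Hd). exact H.
Qed.

Lemma cont2_pt f (U : R -> R -> Prop) u v :
  open2 U -> cont2 f U -> U u v -> continuity_2d_pt f u v.
Proof.
  intros HU Hf Huv eps.
  destruct (Hf u v Huv eps (cond_pos eps)) as [d [Hd H]].
  destruct (open2_locally U u v HU Huv) as [d' H'].
  assert (Hm : 0 < Rmin d d') by (apply Rmin_pos; [exact Hd | apply cond_pos]).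
  exists (mkposreal _ Hm). intros u' v' Hu Hv; simpl in Hu, Hv.
  pose proof (Rmin_l d d'). pose proof (Rmin_r d d').
  apply H; try lra. apply H'; lra.
Qed.

Lemma pt_cont2 f (U : R -> R -> Prop) :
  (forall u v, U u v -> continuity_2d_pt f u v) -> cont2 f U.
Proof.
  intros Hf u v Huv eps Heps.
  destruct (Hf u v Huv (mkposreal eps Heps)) as [d H].
  exists d. split; [apply cond_pos |]. intros u' v' _ Hu Hv. apply H; assumption.
Qed.

(** [pd_u] is an [epsilon] choice. Uniqueness of limits identifies it with any derivative that is
    known to exist, so the default value never enters. *)
Lemma pd_u_eq f u v l :
  derivable_pt_lim (fun s => f s v) u l -> pd_u f u v = l.
Proof.
  intros H. apply (uniqueness_limite (fun s => f s v) u); [| exact H].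
  unfold pd_u. apply epsilon_spec. exists l. exact H.
Qed.

Lemma pd_v_eq f u v l :
  derivable_pt_lim (fun t => f u t) v l -> pd_v f u v = l.
Proof. exact (pd_u_eq (fun a b => f b a) v u l). Qed.

Lemma pd_u_lim f U u v :
  has_pd_u f U -> U u v -> derivable_pt_lim (fun s => f s v) u (pd_u f u v).
Proof. intros H Huv. unfold pd_u. apply epsilon_spec. apply H, Huv. Qed.

Lemma pd_v_lim f U u v :
  has_pd_v f U -> U u v -> derivable_pt_lim (fun t => f u t) v (pd_v f u v).
Proof. intros H Huv. unfold pd_v. apply epsilon_spec. apply H, Huv. Qed.

Lemma derivable_pt_lim_eq f s l l' :
  l = l' -> derivable_pt_lim f s l -> derivable_pt_lim f s l'.
Proof. now intros ->. Qed.

Lemma derivable_pt_lim_ext_u f g (U : R -> R -> Prop) u v l :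
  open2 U -> U u v -> (forall a b, U a b -> f a b = g a b) ->
  derivable_pt_lim (fun s => f s v) u l -> derivable_pt_lim (fun s => g s v) u l.
Proof.
  intros HU Huv Hfg H. apply is_derive_Reals.
  apply is_derive_ext_loc with (fun s => f s v); [| now apply is_derive_Reals].
  apply (locally_2d_1d_const_y (fun s t => f s t = g s t)).
  destruct (open2_locally U u v HU Huv) as [d Hd].
  exists d. intros; now apply Hfg, Hd.
Qed.

Lemma derivable_pt_lim_ext_v f g (U : R -> R -> Prop) u v l :
  open2 U -> U u v -> (forall a b, U a b -> f a b = g a b) ->
  derivable_pt_lim (fun t => f u t) v l -> derivable_pt_lim (fun t => g u t) v l.
Proof.
  intros HU Huv Hfg H. apply is_derive_Reals.
  apply is_derive_ext_loc with (fun t => f u t); [| now apply is_derive_Reals].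
  apply (locally_2d_1d_const_x (fun s t => f s t = g s t)).
  destruct (open2_locally U u v HU Huv) as [d Hd].
  exists d. intros; now apply Hfg, Hd.
Qed.

Lemma cont2_ext f g (U : R -> R -> Prop) :
  (forall a b, U a b -> f a b = g a b) -> cont2 f U -> cont2 g U.
Proof.
  intros Hfg Hf u v Huv eps Heps. destruct (Hf u v Huv eps Heps) as [d [Hd H]].
  exists d. split; [exact Hd |]. intros u' v' Hu' Hu Hv.
  rewrite <- !Hfg by assumption. now apply H.
Qed.

(** [pd_u f] agrees with [fu] only on [U]; elsewhere it may be an arbitrary [epsilon] value.
    Quantifying over all functions that agree with [fu] on [U] lets this rule serve in the proof of
    [Ck_ext], after which the plainer [CkS_intro_Ck] becomes available. *)
Lemma CkS_intro k f fu fv (U : R -> R -> Prop) :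
  open2 U -> cont2 f U ->
  (forall u v, U u v -> derivable_pt_lim (fun s => f s v) u (fu u v)) ->
  (forall u v, U u v -> derivable_pt_lim (fun t => f u t) v (fv u v)) ->
  (forall g, (forall a b, U a b -> fu a b = g a b) -> Ck k g U) ->
  (forall g, (forall a b, U a b -> fv a b = g a b) -> Ck k g U) ->
  Ck (S k) f U.
Proof.
  intros HU Hc Hu Hv Hku Hkv. simpl. repeat split.
  - exact Hc.
  - intros u v H. exists (fu u v). now apply Hu.
  - intros u v H. exists (fv u v). now apply Hv.
  - apply Hku. intros a b H. symmetry. now apply pd_u_eq, Hu.
  - apply Hkv. intros a b H. symmetry. now apply pd_v_eq, Hv.
Qed.

(** On an open set a derivative depends on nearby values only, so agreement on [U] passes to the
    partials and the induction continues with them. *)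
Lemma Ck_ext k : forall f g (U : R -> R -> Prop), open2 U ->
  (forall a b, U a b -> f a b = g a b) -> Ck k f U -> Ck k g U.
Proof.
  induction k as [| k IH]; intros f g U HU Hfg Hf.
  - exact (cont2_ext f g U Hfg Hf).
  - destruct Hf as (Hc & Hu & Hv & Hku & Hkv).
    apply CkS_intro with (pd_u f) (pd_v f); auto.
    + exact (cont2_ext f g U Hfg Hc).
    + intros u v H. apply derivable_pt_lim_ext_u with f U; auto.
      now apply pd_u_lim with U.
    + intros u v H. apply derivable_pt_lim_ext_v with f U; auto.
      now apply pd_v_lim with U.
    + intros h Hh. now apply IH with (pd_u f).
    + intros h Hh. now apply IH with (pd_v f).
Qed.

Lemma CkS_intro_Ck k f fu fv (U : R -> R -> Prop) :
  open2 U -> cont2 f U ->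
  (forall u v, U u v -> derivable_pt_lim (fun s => f s v) u (fu u v)) ->
  (forall u v, U u v -> derivable_pt_lim (fun t => f u t) v (fv u v)) ->
  Ck k fu U -> Ck k fv U -> Ck (S k) f U.
Proof.
  intros HU Hc Hu Hv Hku Hkv. apply CkS_intro with fu fv; auto;
  intros g Hg; [apply Ck_ext with fu | apply Ck_ext with fv]; auto.
Qed.

Lemma Ck_cont2 k f U : Ck k f U -> cont2 f U.
Proof. destruct k; simpl; tauto. Qed.

Lemma Ck_pred k : forall f U, Ck (S k) f U -> Ck k f U.
Proof.
  induction k as [| k IH]; intros f U H.
  - apply H.
  - destruct H as (Hc & Hu & Hv & Hku & Hkv). repeat split; auto.
Qed.

Lemma Ck_subset k : forall f (U V : R -> R -> Prop),
  (forall a b, V a b -> U a b) -> Ck k f U -> Ck k f V.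
Proof.
  assert (Hc : forall f (U V : R -> R -> Prop),
    (forall a b, V a b -> U a b) -> cont2 f U -> cont2 f V).
  { intros f U V HVU Hf u v Huv eps Heps.
    destruct (Hf u v (HVU _ _ Huv) eps Heps) as [d [Hd H]].
    exists d. split; auto. }
  induction k as [| k IH]; intros f U V HVU Hf.
  - exact (Hc f U V HVU Hf).
  - destruct Hf as (Hf & Hu & Hv & Hku & Hkv). repeat split.
    + exact (Hc f U V HVU Hf).
    + intros u v H. apply Hu; auto.
    + intros u v H. apply Hv; auto.
    + now apply IH with U.
    + now apply IH with U.
Qed.

Lemma Ck_const k c (U : R -> R -> Prop) : open2 U -> Ck k (fun _ _ => c) U.
Proof.
  intros HU. revert c. induction k as [| k IH]; intros c.
  - apply pt_cont2. intros. apply continuity_2d_pt_const.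
  - apply CkS_intro_Ck with (fun _ _ => 0) (fun _ _ => 0); auto.
    + apply pt_cont2. intros. apply continuity_2d_pt_const.
    + intros. apply derivable_pt_lim_const.
    + intros. apply derivable_pt_lim_const.
Qed.

Lemma Ck_plus k : forall f g (U : R -> R -> Prop), open2 U ->
  Ck k f U -> Ck k g U -> Ck k (fun u v => f u v + g u v) U.
Proof.
  assert (Hc : forall f g (U : R -> R -> Prop), open2 U ->
    cont2 f U -> cont2 g U -> cont2 (fun u v => f u v + g u v) U).
  { intros f g U HU Hf Hg. apply pt_cont2. intros u v H.
    apply continuity_2d_pt_plus; apply cont2_pt with U; auto. }
  induction k as [| k IH]; intros f g U HU Hf Hg.
  - now apply Hc.
  - destruct Hf as (Hf & Hfu & Hfv & Hfku & Hfkv), Hg as (Hg & Hgu & Hgv & Hgku & Hgkv).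
    apply CkS_intro_Ck with (fun u v => pd_u f u v + pd_u g u v)
                            (fun u v => pd_v f u v + pd_v g u v); auto.
    + intros u v H. apply (derivable_pt_lim_plus (fun s => f s v) (fun s => g s v));
      apply pd_u_lim with U; auto.
    + intros u v H. apply (derivable_pt_lim_plus (fun t => f u t) (fun t => g u t));
      apply pd_v_lim with U; auto.
Qed.

Lemma Ck_mult k : forall f g (U : R -> R -> Prop), open2 U ->
  Ck k f U -> Ck k g U -> Ck k (fun u v => f u v * g u v) U.
Proof.
  assert (Hc : forall f g (U : R -> R -> Prop), open2 U ->
    cont2 f U -> cont2 g U -> cont2 (fun u v => f u v * g u v) U).
  { intros f g U HU Hf Hg. apply pt_cont2. intros u v H.
    apply continuity_2d_pt_mult; apply cont2_pt with U; auto. }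
  induction k as [| k IH]; intros f g U HU Hf Hg.
  - now apply Hc.
  - pose proof (Ck_pred k f U Hf) as Hf'. pose proof (Ck_pred k g U Hg) as Hg'.
    destruct Hf as (Hf & Hfu & Hfv & Hfku & Hfkv), Hg as (Hg & Hgu & Hgv & Hgku & Hgkv).
    apply CkS_intro_Ck with (fun u v => pd_u f u v * g u v + f u v * pd_u g u v)
                            (fun u v => pd_v f u v * g u v + f u v * pd_v g u v);
      auto using Ck_plus.
    + intros u v H. apply (derivable_pt_lim_mult (fun s => f s v) (fun s => g s v));
      apply pd_u_lim with U; auto.
    + intros u v H. apply (derivable_pt_lim_mult (fun t => f u t) (fun t => g u t));
      apply pd_v_lim with U; auto.
Qed.

Lemma Ck_opp k f (U : R -> R -> Prop) : open2 U ->
  Ck k f U -> Ck k (fun u v => - f u v) U.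
Proof.
  intros HU Hf. apply Ck_ext with (fun u v => (-1) * f u v); auto.
  - intros; ring.
  - apply Ck_mult; auto. now apply Ck_const.
Qed.

Lemma derivable_pt_lim_Rpower_comp (h : R -> R) c s l :
  0 < h s -> derivable_pt_lim h s l ->
  derivable_pt_lim (fun t => Rpower (h t) c) s (c * Rpower (h s) (c - 1) * l).
Proof.
  intros Hp H. apply (derivable_pt_lim_comp h (fun r => Rpower r c)); auto.
  now apply derivable_pt_lim_power.
Qed.

(** The exponent is generalised in the induction because differentiation lowers it by one. *)
Lemma Ck_Rpower k : forall f c (U : R -> R -> Prop), open2 U ->
  (forall u v, U u v -> 0 < f u v) -> Ck k f U -> Ck k (fun u v => Rpower (f u v) c) U.
Proof.
  assert (Hc : forall f c (U : R -> R -> Prop), open2 U ->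
    (forall u v, U u v -> 0 < f u v) -> cont2 f U -> cont2 (fun u v => Rpower (f u v) c) U).
  { intros f c U HU Hp Hf. apply pt_cont2. intros u v H.
    apply (continuity_1d_2d_pt_comp (fun r => Rpower r c)).
    - apply derivable_continuous_pt. eexists.
      apply derivable_pt_lim_power. now apply Hp.
    - now apply cont2_pt with U. }
  induction k as [| k IH]; intros f c U HU Hp Hf.
  - now apply Hc.
  - pose proof (Ck_pred k f U Hf) as Hf'.
    destruct Hf as (Hf & Hfu & Hfv & Hfku & Hfkv).
    apply CkS_intro_Ck with (fun u v => c * Rpower (f u v) (c - 1) * pd_u f u v)
                            (fun u v => c * Rpower (f u v) (c - 1) * pd_v f u v);
      auto using Ck_mult, Ck_const.
    + intros u v H. apply (derivable_pt_lim_Rpower_comp (fun s => f s v)); auto.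
      apply pd_u_lim with U; auto.
    + intros u v H. apply (derivable_pt_lim_Rpower_comp (fun t => f u t)); auto.
      apply pd_v_lim with U; auto.
Qed.

(** [Rpower] needs a positive base while [f] may be negative, hence the detour through [f] times the
    power -1 of [f^2]. *)
Lemma Ck_inv k f (U : R -> R -> Prop) : open2 U ->
  (forall u v, U u v -> f u v <> 0) -> Ck k f U -> Ck k (fun u v => / f u v) U.
Proof.
  intros HU Hn Hf.
  assert (Hp : forall u v, U u v -> 0 < f u v * f u v).
  { intros u v H. specialize (Hn u v H). nra. }
  apply Ck_ext with (fun u v => f u v * Rpower (f u v * f u v) (- (1))); auto.
  - intros a b H. specialize (Hn a b H). rewrite Rpower_Ropp, Rpower_1 by auto.
    field; auto.
  - apply Ck_mult; auto. apply (Ck_Rpower k (fun u v => f u v * f u v)); auto.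
    now apply Ck_mult.
Qed.

(** * Differentiability, the chain rule and symmetry of second partials *)

Lemma partials_differentiable f fu fv (U : R -> R -> Prop) u v : open2 U ->
  (forall a b, U a b -> derivable_pt_lim (fun s => f s b) a (fu a b)) ->
  (forall a b, U a b -> derivable_pt_lim (fun t => f a t) b (fv a b)) ->
  cont2 fu U -> U u v -> differentiable_pt_lim f u v (fu u v) (fv u v).
Proof.
  intros HU Hu Hv Hc Huv. apply filterdiff_differentiable_pt_lim.
  (* Total differentiability follows from one partial that exists nearby and is continuous at the
     point, together with the other partial at the point alone. *)
  apply (is_derive_filterdiff f u v fu (fv u v)).
  - apply (locally_2d_locally (fun a b => is_derive (fun s => f s b) a (fu a b)) u v).
    destruct (open2_locally U u v HU Huv) as [d Hd].
    exists d. intros a b Ha Hb. apply is_derive_Reals. auto.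
  - apply is_derive_Reals. auto.
  - apply continuity_2d_pt_filterlim. apply cont2_pt with U; auto.
Qed.

Lemma Ck1_differentiable f (U : R -> R -> Prop) u v :
  open2 U -> Ck 1 f U -> U u v ->
  differentiable_pt_lim f u v (pd_u f u v) (pd_v f u v).
Proof.
  intros HU (Hc & Hu & Hv & Hcu & Hcv) Huv. apply partials_differentiable with U; auto;
  intros; [apply pd_u_lim with U | apply pd_v_lim with U]; auto.
Qed.

(** Continuity of [f] is drawn from total differentiability; this suits potentials, which are known
    only through their partials. *)
Lemma Ck1_intro f fu fv (U : R -> R -> Prop) : open2 U ->
  (forall a b, U a b -> derivable_pt_lim (fun s => f s b) a (fu a b)) ->
  (forall a b, U a b -> derivable_pt_lim (fun t => f a t) b (fv a b)) ->
  cont2 fu U -> cont2 fv U -> Ck 1 f U.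
Proof.
  intros HU Hu Hv Cu Cv. apply CkS_intro_Ck with fu fv; auto.
  apply pt_cont2. intros u v H. apply differentiable_continuity_pt.
  exists (fu u v), (fv u v). now apply partials_differentiable with U.
Qed.

Lemma continuity_2d_pt_comp f p1 p2 s t :
  continuity_2d_pt f (p1 s t) (p2 s t) ->
  continuity_2d_pt p1 s t -> continuity_2d_pt p2 s t ->
  continuity_2d_pt (fun a b => f (p1 a b) (p2 a b)) s t.
Proof.
  intros Hf H1 H2 eps. destruct (Hf eps) as [d Hd].
  generalize (locally_2d_and _ _ _ _ (H1 d) (H2 d)).
  intros [d' H]. exists d'. intros a b Ha Hb. apply Hd; now apply H.
Qed.

Section Composition.
Variables (U V : R -> R -> Prop) (p1 p2 : R -> R -> R).
Hypothesis HU : open2 U.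
Hypothesis HV : open2 V.
Hypothesis Hmap : forall s t, V s t -> U (p1 s t) (p2 s t).

Lemma derivable_pt_lim_comp_u f s t l1 l2 : Ck 1 f U -> V s t ->
  derivable_pt_lim (fun a => p1 a t) s l1 -> derivable_pt_lim (fun a => p2 a t) s l2 ->
  derivable_pt_lim (fun a => f (p1 a t) (p2 a t)) s
    (pd_u f (p1 s t) (p2 s t) * l1 + pd_v f (p1 s t) (p2 s t) * l2).
Proof.
  intros Hf Hst H1 H2.
  apply (derivable_pt_lim_comp_2d f (fun a => p1 a t) (fun a => p2 a t)); auto.
  apply Ck1_differentiable with U; auto.
Qed.

Lemma derivable_pt_lim_comp_v f s t l1 l2 : Ck 1 f U -> V s t ->
  derivable_pt_lim (fun b => p1 s b) t l1 -> derivable_pt_lim (fun b => p2 s b) t l2 ->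
  derivable_pt_lim (fun b => f (p1 s b) (p2 s b)) t
    (pd_u f (p1 s t) (p2 s t) * l1 + pd_v f (p1 s t) (p2 s t) * l2).
Proof.
  intros Hf Hst H1 H2.
  apply (derivable_pt_lim_comp_2d f (fun b => p1 s b) (fun b => p2 s b)); auto.
  apply Ck1_differentiable with U; auto.
Qed.

Lemma Ck_comp k : forall f, Ck k f U -> Ck k p1 V -> Ck k p2 V ->
  Ck k (fun s t => f (p1 s t) (p2 s t)) V.
Proof.
  assert (Hc : forall f, cont2 f U -> cont2 p1 V -> cont2 p2 V ->
    cont2 (fun s t => f (p1 s t) (p2 s t)) V).
  { intros f Hf H1 H2. apply pt_cont2. intros s t H.
    apply continuity_2d_pt_comp; [apply cont2_pt with U | apply cont2_pt with V
      | apply cont2_pt with V]; auto. }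
  induction k as [| k IH]; intros f Hf H1 H2.
  - now apply Hc.
  - pose proof (Ck_pred k _ _ H1). pose proof (Ck_pred k _ _ H2).
    assert (Hf1 : Ck 1 f U).
    { destruct Hf as (? & ? & ? & Ha & Hb). repeat split; auto;
      eapply Ck_cont2; eauto. }
    destruct Hf as (Hf & Hfu & Hfv & Hfku & Hfkv).
    destruct H1 as (H1 & H1u & H1v & H1ku & H1kv), H2 as (H2 & H2u & H2v & H2ku & H2kv).
    apply CkS_intro_Ck with
      (fun s t => pd_u f (p1 s t) (p2 s t) * pd_u p1 s t + pd_v f (p1 s t) (p2 s t) * pd_u p2 s t)
      (fun s t => pd_u f (p1 s t) (p2 s t) * pd_v p1 s t + pd_v f (p1 s t) (p2 s t) * pd_v p2 s t);
      auto using Ck_plus, Ck_mult.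
    + intros s t H'. apply derivable_pt_lim_comp_u; auto; apply pd_u_lim with V; auto.
    + intros s t H'. apply derivable_pt_lim_comp_v; auto; apply pd_v_lim with V; auto.
Qed.

(* Bootstrapping: if [p] solves [dp = F o p] with [F] smooth, then [p] is as
   smooth as [F]. *)
Lemma Ck_bootstrap F1u F1v F2u F2v :
  smooth F1u U -> smooth F1v U -> smooth F2u U -> smooth F2v U ->
  cont2 p1 V -> cont2 p2 V ->
  (forall s t, V s t -> derivable_pt_lim (fun a => p1 a t) s (F1u (p1 s t) (p2 s t))) ->
  (forall s t, V s t -> derivable_pt_lim (fun b => p1 s b) t (F1v (p1 s t) (p2 s t))) ->
  (forall s t, V s t -> derivable_pt_lim (fun a => p2 a t) s (F2u (p1 s t) (p2 s t))) ->
  (forall s t, V s t -> derivable_pt_lim (fun b => p2 s b) t (F2v (p1 s t) (p2 s t))) ->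
  forall k, Ck k p1 V /\ Ck k p2 V.
Proof.
  intros S1u S1v S2u S2v C1 C2 D1u D1v D2u D2v k.
  induction k as [| k [IH1 IH2]]; [now split |].
  split.
  - apply CkS_intro_Ck with (fun s t => F1u (p1 s t) (p2 s t))
      (fun s t => F1v (p1 s t) (p2 s t)); auto; apply Ck_comp; auto.
  - apply CkS_intro_Ck with (fun s t => F2u (p1 s t) (p2 s t))
      (fun s t => F2v (p1 s t) (p2 s t)); auto; apply Ck_comp; auto.
Qed.
End Composition.

(** [Schwarz] is stated with [Derive], so the iterated partials are first identified with iterated
    [Derive] on all of [U], not just at the point: its hypotheses concern a neighbourhood. *)
Lemma pd_v_pd_u f (U : R -> R -> Prop) u v :
  open2 U -> Ck 2 f U -> U u v -> pd_v (pd_u f) u v = pd_u (pd_v f) u v.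
Proof.
  intros HU Hf Huv. destruct Hf as (Hc & Hu & Hv & (Hcu & Huu & Huv' & Cuu & Cuv) &
    (Hcv & Hvu & Hvv & Cvu & Cvv)).
  assert (Du : forall a b, U a b -> Derive (fun s => f s b) a = pd_u f a b).
  { intros a b H. apply is_derive_unique, is_derive_Reals, pd_u_lim with U; auto. }
  assert (Dv : forall a b, U a b -> Derive (fun t => f a t) b = pd_v f a b).
  { intros a b H. apply is_derive_unique, is_derive_Reals, pd_v_lim with U; auto. }
  assert (Duv : forall a b, U a b ->
    is_derive (fun t => Derive (fun s => f s t) a) b (pd_v (pd_u f) a b)).
  { intros a b H. apply is_derive_Reals.
    apply derivable_pt_lim_ext_v with (f := pd_u f) (U := U) (g := fun a t => Derive (fun s => f s t) a); auto.
    - intros; symmetry; auto.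
    - apply pd_v_lim with U; auto. }
  assert (Dvu : forall a b, U a b ->
    is_derive (fun s => Derive (fun t => f s t) b) a (pd_u (pd_v f) a b)).
  { intros a b H. apply is_derive_Reals.
    apply derivable_pt_lim_ext_u with (f := pd_v f) (U := U) (g := fun s b => Derive (fun t => f s t) b); auto.
    - intros; symmetry; auto.
    - apply pd_u_lim with U; auto. }
  destruct (open2_locally U u v HU Huv) as [d Hd].
  rewrite <- (is_derive_unique _ _ _ (Duv u v Huv)), <- (is_derive_unique _ _ _ (Dvu u v Huv)).
  symmetry. apply (Schwarz f u v).
  - exists d. intros a b Ha Hb. specialize (Hd a b Ha Hb). repeat split.
    + eexists. apply is_derive_Reals. apply pd_u_lim with U; auto.
    + eexists. apply is_derive_Reals. apply pd_v_lim with U; auto.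
    + eexists. now apply Dvu.
    + eexists. now apply Duv.
  - apply continuity_2d_pt_ext_loc with (pd_u (pd_v f)).
    + exists d. intros a b Ha Hb. symmetry. apply is_derive_unique, Dvu; auto.
    + apply cont2_pt with U; auto.
  - apply continuity_2d_pt_ext_loc with (pd_v (pd_u f)).
    + exists d. intros a b Ha Hb. symmetry. apply is_derive_unique, Duv; auto.
    + apply cont2_pt with U; auto.
Qed.

(** * Potentials and local inverses *)

(** A ball of the sup norm: it has the shape of the neighbourhoods in [open2] and contains the
    axis-parallel paths from its centre along which forms are integrated. *)
Definition square (u0 v0 r u v : R) : Prop := Rabs (u - u0) < r /\ Rabs (v - v0) < r.

Lemma square_open u0 v0 r : open2 (square u0 v0 r).
Proof.
  intros u v [Hu Hv]. exists (Rmin (r - Rabs (u - u0)) (r - Rabs (v - v0))). split.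
  - apply Rmin_pos; lra.
  - intros u' v' Hu' Hv'.
    pose proof (Rmin_l (r - Rabs (u - u0)) (r - Rabs (v - v0))).
    pose proof (Rmin_r (r - Rabs (u - u0)) (r - Rabs (v - v0))).
    split.
    + replace (u' - u0) with ((u' - u) + (u - u0)) by ring.
      eapply Rle_lt_trans; [apply Rabs_triang | lra].
    + replace (v' - v0) with ((v' - v) + (v - v0)) by ring.
      eapply Rle_lt_trans; [apply Rabs_triang | lra].
Qed.

Lemma square_center u0 v0 r : 0 < r -> square u0 v0 r u0 v0.
Proof. intros H. split; rewrite Rminus_eq_0, Rabs_R0; exact H. Qed.

Lemma between_close u0 u s r :
  Rmin u0 u <= s <= Rmax u0 u -> Rabs (u - u0) < r -> Rabs (s - u0) < r.
Proof.
  intros Hs H. apply Rabs_def2 in H. apply Rabs_def1;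
  unfold Rmin, Rmax in Hs; destruct (Rle_dec u0 u); lra.
Qed.

(** The potential integrates the form along a vertical segment from the centre and then along a
    horizontal one. Its [u]-derivative is the fundamental theorem of calculus. Its [v]-derivative is
    taken under the horizontal integral, where closedness turns [pd_v a] into [pd_u b], which
    integrates explicitly. *)
Lemma poincare a b (U : R -> R -> Prop) u0 v0 :
  open2 U -> U u0 v0 -> Ck 1 a U -> Ck 1 b U ->
  (forall u v, U u v -> pd_v a u v = pd_u b u v) ->
  exists P r, 0 < r /\ forall u v, square u0 v0 r u v -> U u v /\
    derivable_pt_lim (fun s => P s v) u (a u v) /\
    derivable_pt_lim (fun t => P u t) v (b u v).
Proof.
  intros HU H0 Ha Hb Hab. destruct (HU u0 v0 H0) as (r & Hr & Hsq).
  assert (HS : forall u v, square u0 v0 r u v -> U u v) by (intros u v []; auto).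
  assert (Cau : forall u v, square u0 v0 r u v -> continuous (fun s => a s v) u).
  { intros u v H. apply (ex_derive_continuous (fun s => a s v)). eexists.
    apply is_derive_Reals, pd_u_lim with U; auto. apply Ha. }
  assert (Cbv : forall u v, square u0 v0 r u v -> continuous (fun t => b u t) v).
  { intros u v H. apply (ex_derive_continuous (fun t => b u t)). eexists.
    apply is_derive_Reals, pd_v_lim with U; auto. apply Hb. }
  assert (Dav : forall u v, square u0 v0 r u v -> is_derive (fun t => a u t) v (pd_v a u v)).
  { intros u v H. apply is_derive_Reals, pd_v_lim with U; auto. apply Ha. }
  assert (Dbu : forall u v, square u0 v0 r u v -> is_derive (fun s => b s v) u (pd_u b u v)).
  { intros u v H. apply is_derive_Reals, pd_u_lim with U; auto. apply Hb. }
  assert (Ia : forall u v, square u0 v0 r u v -> ex_RInt (fun s => a s v) u0 u).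
  { intros u v [Hu Hv]. apply (ex_RInt_continuous (fun s => a s v)).
    intros s Hs. apply Cau. split; auto. now apply (between_close u0 u). }
  assert (Ib : forall v, Rabs (v - v0) < r -> ex_RInt (fun t => b u0 t) v0 v).
  { intros v Hv. apply (ex_RInt_continuous (fun t => b u0 t)).
    intros t Ht. apply Cbv. split; [rewrite Rminus_eq_0, Rabs_R0; lra |].
    now apply (between_close v0 v). }
  exists (fun u v => RInt (fun s => a s v) u0 u + RInt (fun t => b u0 t) v0 v), r.
  split; [exact Hr |]. intros u v H.
  destruct (open2_locally _ u v (square_open u0 v0 r) H) as [d Hd].
  assert (Hd1 : forall s, Rabs (s - u) < d -> square u0 v0 r s v).
  { intros s Hs. apply Hd; auto. rewrite Rminus_eq_0, Rabs_R0. apply cond_pos. }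
  assert (Hd2 : forall t, Rabs (t - v) < d -> square u0 v0 r u t).
  { intros t Ht. apply Hd; auto. rewrite Rminus_eq_0, Rabs_R0. apply cond_pos. }
  repeat split.
  - now apply HS.
  - eapply derivable_pt_lim_eq; [apply Rplus_0_r |].
    apply (derivable_pt_lim_plus (fun s => RInt (fun s => a s v) u0 s)
      (fun _ => RInt (fun t => b u0 t) v0 v)); [| apply derivable_pt_lim_const].
    apply is_derive_Reals.
    apply (is_derive_RInt (fun s => a s v) (fun s => RInt (fun s => a s v) u0 s) u0 u).
    + exists d. intros s Hs. apply (RInt_correct (fun s => a s v)). apply Ia, Hd1, Hs.
    + now apply Cau.
  - assert (Hb0 : RInt (fun s => Derive (fun t => a s t) v) u0 u = b u v - b u0 v).
    { rewrite <- (RInt_Derive (fun s => b s v) u0 u).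
      - apply RInt_ext. intros s Hs.
        assert (K : square u0 v0 r s v) by (split; [apply (between_close u0 u); [lra |] |]; apply H).
        transitivity (pd_v a s v); [now apply is_derive_unique, Dav |].
        transitivity (pd_u b s v); [now apply Hab, HS |].
        symmetry. now apply is_derive_unique, Dbu.
      - intros s Hs. eexists. apply Dbu. split; [apply (between_close u0 u); [lra |] |]; apply H.
      - intros s Hs.
        assert (K : square u0 v0 r s v) by (split; [apply (between_close u0 u); [lra |] |]; apply H).
        apply (continuous_ext_loc _ (fun s => pd_u b s v)).
        + destruct (open2_locally _ s v (square_open u0 v0 r) K) as [e He].
          exists e. intros s' Hs'. symmetry. apply is_derive_unique, Dbu.
          apply He; [exact Hs' |]. rewrite Rminus_eq_0, Rabs_R0. apply cond_pos.
        + apply continuity_pt_filterlim. intros eps Heps.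
          destruct Hb as (_ & _ & _ & Hbu & _).
          destruct (cont2_pt _ U s v HU Hbu (HS _ _ K) (mkposreal eps Heps)) as [e He].
          exists e. split; [apply cond_pos |]. intros s' [_ Hs']. apply He; [exact Hs' |].
          rewrite Rminus_eq_0, Rabs_R0. apply cond_pos. }
    (* The boundary term [- b u0 v] of the horizontal integral is compensated by the derivative of
       the vertical one. *)
    apply derivable_pt_lim_eq with ((b u v - b u0 v) + b u0 v); [ring |].
    apply (derivable_pt_lim_plus (fun t => RInt (fun s => a s t) u0 u)
      (fun t => RInt (fun t => b u0 t) v0 t)).
    + apply is_derive_Reals. rewrite <- Hb0.
      apply (is_derive_RInt_param (fun t s => a s t) u0 u v).
      * exists d. intros t Ht s Hs. eexists. apply Dav.
        destruct (Hd2 t Ht). split; [now apply (between_close u0 u) | assumption].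
      * intros s Hs.
        assert (K : square u0 v0 r s v) by (split; [apply (between_close u0 u); [lra |] |]; apply H).
        destruct Ha as (_ & _ & _ & _ & Hav).
        apply continuity_2d_pt_ext_loc with (fun t s => pd_v a s t).
        -- destruct (open2_locally _ s v (square_open u0 v0 r) K) as [e He].
           exists e. intros t' s' Ht' Hs'. symmetry. apply is_derive_unique, Dav.
           now apply He.
        -- intros eps. destruct (cont2_pt _ U s v HU Hav (HS _ _ K) eps) as [e He].
           exists e. intros; now apply He.
      * exists d. intros t Ht. apply Ia, Hd2, Ht.
    + apply is_derive_Reals.
      apply (is_derive_RInt (fun t => b u0 t) (fun t => RInt (fun t => b u0 t) v0 t) v0 v).
      * exists d. intros t Ht. apply (RInt_correct (fun t => b u0 t)). apply Ib, Hd2, Ht.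
      * apply Cbv. split; [rewrite Rminus_eq_0, Rabs_R0; lra | apply H].
Qed.

(** * Contractions and the local inverse *)

Lemma contraction_fixed_point (T1 T2 : R -> R -> R) u0 v0 r : 0 < r ->
  (forall u v, Rabs (u - u0) <= r -> Rabs (v - v0) <= r ->
    Rabs (T1 u v - u0) <= r /\ Rabs (T2 u v - v0) <= r) ->
  (forall u v u' v', Rabs (u - u0) <= r -> Rabs (v - v0) <= r ->
    Rabs (u' - u0) <= r -> Rabs (v' - v0) <= r ->
    Rabs (T1 u v - T1 u' v') + Rabs (T2 u v - T2 u' v')
      <= / 2 * (Rabs (u - u') + Rabs (v - v'))) ->
  exists u v, Rabs (u - u0) <= r /\ Rabs (v - v0) <= r /\ T1 u v = u /\ T2 u v = v.
Proof.
  intros Hr Hmap Hcontr.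
  (* Picard iteration from the centre, with distances measured as the sum of the coordinate
     distances. The square is closed, so the limit stays in it. *)
  pose (q := fix q n := match n with O => (u0, v0)
    | S n => (T1 (fst (q n)) (snd (q n)), T2 (fst (q n)) (snd (q n))) end).
  assert (Hq : forall n, Rabs (fst (q n) - u0) <= r /\ Rabs (snd (q n) - v0) <= r).
  { induction n as [| n IH]; simpl.
    - rewrite !Rminus_eq_0, Rabs_R0. lra.
    - apply Hmap; apply IH. }
  set (C := Rabs (fst (q 1%nat) - fst (q 0%nat)) + Rabs (snd (q 1%nat) - snd (q 0%nat))).
  assert (Hgeom : forall n, Rabs (fst (q (S n)) - fst (q n)) + Rabs (snd (q (S n)) - snd (q n))
    <= C * (/ 2) ^ n).
  { induction n as [| n IH].
    - unfold C. simpl pow. lra.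
    - destruct (Hq n), (Hq (S n)).
      eapply Rle_trans; [apply (Hcontr (fst (q (S n))) (snd (q (S n))) (fst (q n)) (snd (q n))); auto |].
      simpl pow. lra. }
  assert (Hlim : forall p : nat -> R, (forall n, Rabs (p (S n) - p n) <= C * (/ 2) ^ n) ->
    exists l : R, is_lim_seq p (Finite l)).
  { intros p Hp.
    assert (Hs : ex_series (fun n => p (S n) - p n)).
    { apply (ex_series_le (fun n => p (S n) - p n) (fun n => C * (/ 2) ^ n)).
      - exact Hp.
      - apply (ex_series_scal_l C (fun n => (/ 2) ^ n)). apply ex_series_geom.
        rewrite Rabs_pos_eq; lra. }
    (* The partial sum up to [n] telescopes to [p (S n) - p O], hence the shifted sequence and the
       added [p O]. *)
    destruct Hs as [l Hl]. exists (l + p O).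
    apply is_lim_seq_incr_1.
    apply is_lim_seq_ext with (fun n => sum_n (fun n => p (S n) - p n) n + p O).
    - induction n as [| n IH].
      + rewrite sum_O. ring.
      + rewrite sum_Sn. unfold plus; simpl. lra.
    - apply is_lim_seq_plus'; [exact Hl | apply is_lim_seq_const]. }
  destruct (Hlim (fun n => fst (q n))) as [l1 L1].
  { intros n. pose proof (Hgeom n). pose proof (Rabs_pos (snd (q (S n)) - snd (q n))). lra. }
  destruct (Hlim (fun n => snd (q n))) as [l2 L2].
  { intros n. pose proof (Hgeom n). pose proof (Rabs_pos (fst (q (S n)) - fst (q n))). lra. }
  assert (Hl : forall p l c, is_lim_seq p (Finite l) -> is_lim_seq (fun n => Rabs (p n - c)) (Rabs (l - c))).
  { intros p l c Hp. apply (is_lim_seq_abs (fun n => p n - c) (l - c)).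
    apply is_lim_seq_minus'; [exact Hp | apply is_lim_seq_const]. }
  assert (B1 : Rabs (l1 - u0) <= r).
  { apply (is_lim_seq_le (fun n => Rabs (fst (q n) - u0)) (fun _ => r) (Rabs (l1 - u0)) r);
    [intros n; apply Hq | exact (Hl _ _ u0 L1) | apply is_lim_seq_const]. }
  assert (B2 : Rabs (l2 - v0) <= r).
  { apply (is_lim_seq_le (fun n => Rabs (snd (q n) - v0)) (fun _ => r) (Rabs (l2 - v0)) r);
    [intros n; apply Hq | exact (Hl _ _ v0 L2) | apply is_lim_seq_const]. }
  (* The distance from the limit to its image is bounded by the contraction estimate against an
     iterate plus the distance from the next iterate to the limit; both tend to 0. *)
  assert (HT : Rabs (T1 l1 l2 - l1) + Rabs (T2 l1 l2 - l2) <= 0).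
  { apply (is_lim_seq_le (fun _ => Rabs (T1 l1 l2 - l1) + Rabs (T2 l1 l2 - l2))
      (fun n => / 2 * (Rabs (fst (q n) - l1) + Rabs (snd (q n) - l2))
        + (Rabs (fst (q (S n)) - l1) + Rabs (snd (q (S n)) - l2)))
      (Finite (Rabs (T1 l1 l2 - l1) + Rabs (T2 l1 l2 - l2))) (Finite 0)).
    - intros n. destruct (Hq n) as [Hn1 Hn2].
      pose proof (Hcontr l1 l2 (fst (q n)) (snd (q n)) B1 B2 Hn1 Hn2) as Hc.
      change (T1 (fst (q n)) (snd (q n))) with (fst (q (S n))) in Hc.
      change (T2 (fst (q n)) (snd (q n))) with (snd (q (S n))) in Hc.
      rewrite (Rabs_minus_sym l1), (Rabs_minus_sym l2) in Hc.
      pose proof (Rabs_triang (T1 l1 l2 - fst (q (S n))) (fst (q (S n)) - l1)) as Ht1.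
      pose proof (Rabs_triang (T2 l1 l2 - snd (q (S n))) (snd (q (S n)) - l2)) as Ht2.
      replace (T1 l1 l2 - fst (q (S n)) + (fst (q (S n)) - l1)) with (T1 l1 l2 - l1) in Ht1 by ring.
      replace (T2 l1 l2 - snd (q (S n)) + (snd (q (S n)) - l2)) with (T2 l1 l2 - l2) in Ht2 by ring.
      lra.
    - apply is_lim_seq_const.
    - pose proof (Hl _ _ l1 L1) as K1. pose proof (Hl _ _ l2 L2) as K2.
      rewrite Rminus_eq_0, Rabs_R0 in K1, K2. simpl in K1, K2.
      replace 0 with (/ 2 * (0 + 0) + (0 + 0)) by field.
      apply is_lim_seq_plus'.
      + apply (is_lim_seq_scal_l _ (/ 2) (Finite (0 + 0))). now apply is_lim_seq_plus'.
      + apply is_lim_seq_plus'; [apply (is_lim_seq_incr_1 (fun n => Rabs (fst (q n) - l1)))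
          | apply (is_lim_seq_incr_1 (fun n => Rabs (snd (q n) - l2)))]; assumption. }
  exists l1, l2. repeat split; auto; apply Rminus_diag_uniq;
  pose proof (Rabs_pos (T1 l1 l2 - l1)); pose proof (Rabs_pos (T2 l1 l2 - l2));
  match goal with |- ?a = 0 => destruct (Req_dec a 0) as [E | E]; [exact E |];
    apply Rabs_pos_lt in E; lra end.
Qed.

Lemma mvt_bound (f f' : R -> R) a b c :
  (forall s, Rmin a b <= s <= Rmax a b -> derivable_pt_lim f s (f' s) /\ Rabs (f' s) <= c) ->
  Rabs (f b - f a) <= c * Rabs (b - a).
Proof.
  intros H. destruct (MVT_gen f a b f') as (s & Hs & E).
  - intros s Hs. apply is_derive_Reals, H. lra.
  - intros s Hs. apply derivable_continuous_pt. exists (f' s). now apply H.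
  - rewrite E, Rabs_mult. apply Rmult_le_compat_r; [apply Rabs_pos | now apply H].
Qed.

(** By continuity both partials are bounded by [c] near the centre; the mean value theorem is then
    applied along the two sides of the axis-parallel path through [(u', v)]. *)
Lemma small_lipschitz E (U : R -> R -> Prop) u0 v0 c :
  open2 U -> Ck 1 E U -> U u0 v0 -> pd_u E u0 v0 = 0 -> pd_v E u0 v0 = 0 -> 0 < c ->
  exists r, 0 < r /\
    forall u v u' v', Rabs (u - u0) <= r -> Rabs (v - v0) <= r ->
      Rabs (u' - u0) <= r -> Rabs (v' - v0) <= r ->
      Rabs (E u v - E u' v') <= c * (Rabs (u - u') + Rabs (v - v')).
Proof.
  intros HU (HE & HEu & HEv & Cu & Cv) H0 Eu Ev Hc.
  destruct (cont2_pt _ U u0 v0 HU Cu H0 (mkposreal c Hc)) as [d1 D1].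
  destruct (cont2_pt _ U u0 v0 HU Cv H0 (mkposreal c Hc)) as [d2 D2].
  destruct (open2_locally U u0 v0 HU H0) as [d3 D3].
  assert (Hpos : 0 < Rmin (Rmin d1 d2) d3)
    by (repeat apply Rmin_pos; apply cond_pos).
  (* Half the radius, so that the closed square lies in all three open neighbourhoods. *)
  exists (Rmin (Rmin d1 d2) d3 / 2). split; [lra |].
  pose proof (Rmin_l (Rmin d1 d2) d3). pose proof (Rmin_r (Rmin d1 d2) d3).
  pose proof (Rmin_l d1 d2). pose proof (Rmin_r d1 d2).
  set (r := Rmin (Rmin d1 d2) d3 / 2) in *.
  assert (Hr : r < d1 /\ r < d2 /\ r < d3) by (unfold r; lra).
  assert (Hin : forall u v, Rabs (u - u0) <= r -> Rabs (v - v0) <= r ->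
    U u v /\ Rabs (pd_u E u v) <= c /\ Rabs (pd_v E u v) <= c).
  { intros u v Hu Hv. rewrite Eu in D1. rewrite Ev in D2. simpl in D1, D2.
    split; [apply D3; lra |].
    split; apply Rlt_le; rewrite <- (Rminus_0_r (pd_u E u v)) || rewrite <- (Rminus_0_r (pd_v E u v));
    [apply D1 | apply D2]; lra. }
  assert (Hbt : forall a b s c0, Rabs (a - c0) <= r -> Rabs (b - c0) <= r ->
    Rmin a b <= s <= Rmax a b -> Rabs (s - c0) <= r).
  { intros a b s c0 Ha Hb Hs. apply Rabs_le_between in Ha. apply Rabs_le_between in Hb.
    apply Rabs_le_between. unfold Rmin, Rmax in Hs; destruct (Rle_dec a b); lra. }
  intros u v u' v' Hu Hv Hu' Hv'.
  assert (K1 : Rabs (E u v - E u' v) <= c * Rabs (u - u')).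
  { apply (mvt_bound (fun s => E s v) (fun s => pd_u E s v)). intros s Hs.
    destruct (Hin s v) as (I1 & I2 & _); [now apply (Hbt u' u) | exact Hv |].
    split; [apply pd_u_lim with U; auto | exact I2]. }
  assert (K2 : Rabs (E u' v - E u' v') <= c * Rabs (v - v')).
  { apply (mvt_bound (fun t => E u' t) (fun t => pd_v E u' t)). intros t Ht.
    destruct (Hin u' t) as (I1 & _ & I2); [exact Hu' | now apply (Hbt v' v) |].
    split; [apply pd_v_lim with U; auto | exact I2]. }
  replace (E u v - E u' v') with ((E u v - E u' v) + (E u' v - E u' v')) by ring.
  eapply Rle_trans; [apply Rabs_triang | lra].
Qed.

Lemma derivable_pt_lim_little_o e s :
  (forall eps, 0 < eps -> exists d, 0 < d /\
    forall h, Rabs h < d -> Rabs (e (s + h)) <= eps * Rabs h) ->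
  derivable_pt_lim e s 0.
Proof.
  intros H eps Heps. destruct (H (eps / 2)) as (d & Hd & He); [lra |].
  (* The case [h = 0] of the bound forces this value, so the difference quotient reduces to
     [e (s + h) / h]. *)
  assert (E0 : e s = 0).
  { specialize (He 0). rewrite Rplus_0_r, Rabs_R0, Rmult_0_r in He.
    destruct (Req_dec (e s) 0) as [E | E]; [exact E |]. apply Rabs_pos_lt in E. lra. }
  exists (mkposreal d Hd). intros h Hh0 Hh. simpl in Hh. specialize (He h Hh).
  rewrite E0, !Rminus_0_r. unfold Rdiv. rewrite Rabs_mult, Rabs_inv.
  apply Rabs_pos_lt in Hh0.
  apply Rmult_lt_reg_r with (Rabs h); [exact Hh0 |].
  rewrite Rmult_assoc, Rinv_l by lra. nra.
Qed.

(* Differentiating the relation [F o q = affine] along a Lipschitz curve [q]. *)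
Lemma derivable_inverse_curve F1 F2 q1 q2 s a b C d f1u f1v f2u f2v :
  0 < d ->
  (forall h, Rabs h < d -> Rabs (q1 (s + h) - q1 s) + Rabs (q2 (s + h) - q2 s) <= C * Rabs h) ->
  (forall h, Rabs h < d -> F1 (q1 (s + h)) (q2 (s + h)) = F1 (q1 s) (q2 s) + a * h /\
                           F2 (q1 (s + h)) (q2 (s + h)) = F2 (q1 s) (q2 s) + b * h) ->
  differentiable_pt_lim F1 (q1 s) (q2 s) f1u f1v ->
  differentiable_pt_lim F2 (q1 s) (q2 s) f2u f2v ->
  f1u * f2v - f1v * f2u <> 0 ->
  derivable_pt_lim q1 s ((a * f2v - b * f1v) / (f1u * f2v - f1v * f2u)) /\
  derivable_pt_lim q2 s ((b * f1u - a * f2u) / (f1u * f2v - f1v * f2u)).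
Proof.
  intros Hd Hlip Hq D1 D2 HJ.
  assert (HC : 0 <= C).
  { assert (Hd2 : Rabs (d / 2) = d / 2) by (apply Rabs_pos_eq; lra).
    specialize (Hlip (d / 2)). rewrite Hd2 in Hlip.
    pose proof (Rabs_pos (q1 (s + d / 2) - q1 s)).
    pose proof (Rabs_pos (q2 (s + d / 2) - q2 s)).
    assert (0 <= C * (d / 2)) by lra. nra. }
  (* Remainder of the first-order expansion of [F] along the curve. It is small relative to the
     increment of [q], and the Lipschitz bound makes it small relative to [h]. *)
  pose (rem := fun F fu fv t =>
    F (q1 t) (q2 t) - F (q1 s) (q2 s) - (fu * (q1 t - q1 s) + fv * (q2 t - q2 s))).
  assert (Hrem : forall F fu fv, differentiable_pt_lim F (q1 s) (q2 s) fu fv ->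
    derivable_pt_lim (rem F fu fv) s 0).
  { intros F fu fv D. apply derivable_pt_lim_little_o. intros eps Heps.
    assert (Hep : 0 < eps / (C + 1)) by (apply Rdiv_lt_0_compat; lra).
    destruct (D (mkposreal _ Hep)) as [d' Hd'].
    assert (Hm : 0 < d' / (C + 1)) by (apply Rdiv_lt_0_compat; [apply cond_pos | lra]).
    exists (Rmin d (d' / (C + 1))). split; [now apply Rmin_pos |].
    intros h Hh. pose proof (Rmin_l d (d' / (C + 1))). pose proof (Rmin_r d (d' / (C + 1))).
    specialize (Hlip h ltac:(lra)).
    pose proof (Rabs_pos (q1 (s + h) - q1 s)) as P1.
    pose proof (Rabs_pos (q2 (s + h) - q2 s)) as P2. pose proof (Rabs_pos h) as P3.
    assert (Hs : (C + 1) * Rabs h < d').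
    { replace (pos d') with ((C + 1) * (d' / (C + 1))) by (field; lra).
      apply Rmult_lt_compat_l; lra. }
    unfold rem. eapply Rle_trans; [apply Hd'; lra |]. simpl.
    assert (Hmax : Rmax (Rabs (q1 (s + h) - q1 s)) (Rabs (q2 (s + h) - q2 s)) <= (C + 1) * Rabs h)
      by (apply Rmax_lub; lra).
    eapply Rle_trans; [apply Rmult_le_compat_l; [lra | exact Hmax] |].
    right. field. lra. }
  pose proof (Hrem _ _ _ D1) as R1. pose proof (Hrem _ _ _ D2) as R2. clear Hrem.
  set (J := f1u * f2v - f1v * f2u) in *.
  (* Cramer's rule applied to the two expansions writes each coordinate as an affine function plus a
     combination of the remainders, whose derivatives vanish at [s]. The cofactors are supplied as
     [k1] and [k2] at the end. *)
  assert (Lin : forall q k1 k2 c, derivable_pt_lim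
    (fun t => q + (c * (t - s) + k1 * rem F1 f1u f1v t + k2 * rem F2 f2u f2v t) / J) s (c / J)).
  { intros q k1 k2 c. apply is_derive_Reals. apply is_derive_Reals in R1. apply is_derive_Reals in R2.
    auto_derive.
    - repeat split; eexists; eassumption.
    - change (fun x : R => rem F1 f1u f1v x) with (rem F1 f1u f1v).
      change (fun x : R => rem F2 f2u f2v x) with (rem F2 f2u f2v).
      rewrite (is_derive_unique _ _ _ R1), (is_derive_unique _ _ _ R2). field. exact HJ. }
  assert (Loc : forall g q l, (forall h, Rabs h < d -> g (s + h) = q (s + h)) ->
    derivable_pt_lim g s l -> derivable_pt_lim q s l).
  { intros g q l Hg D. apply is_derive_Reals. apply is_derive_Reals in D.
    apply is_derive_ext_loc with g; [| exact D].
    exists (mkposreal d Hd). intros t Ht. replace t with (s + (t - s)) by ring. apply Hg, Ht. }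
  split; (eapply Loc; [| apply Lin]).
  - intros h Hh. destruct (Hq h Hh) as [E1 E2]. unfold rem. rewrite E1, E2.
    instantiate (1 := f1v). instantiate (1 := - f2v). instantiate (1 := q1 s).
    unfold J. field. exact HJ.
  - intros h Hh. destruct (Hq h Hh) as [E1 E2]. unfold rem. rewrite E1, E2.
    instantiate (1 := - f1u). instantiate (1 := f2u). instantiate (1 := q2 s).
    unfold J. field. exact HJ.
Qed.

Definition jac (F1 F2 : R -> R -> R) u v :=
  pd_u F1 u v * pd_v F2 u v - pd_v F1 u v * pd_u F2 u v.

(** Solving [F q = (s, t)] means finding a fixed point of [q - M (F q) + M (s, t)]. The estimate
    that makes this a contraction also makes the inverse Lipschitz, which yields its continuity, its
    value at the centre and, through [derivable_inverse_curve], its partials. *)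
Lemma inverse_function F1 F2 (U : R -> R -> Prop) u0 v0 :
  open2 U -> Ck 1 F1 U -> Ck 1 F2 U -> U u0 v0 ->
  (forall u v, U u v -> jac F1 F2 u v <> 0) ->
  exists V p1 p2, open2 V /\ cont2 p1 V /\ cont2 p2 V /\
    V (F1 u0 v0) (F2 u0 v0) /\
    p1 (F1 u0 v0) (F2 u0 v0) = u0 /\ p2 (F1 u0 v0) (F2 u0 v0) = v0 /\
    forall s t, V s t -> let u := p1 s t in let v := p2 s t in
      U u v /\ F1 u v = s /\ F2 u v = t /\
      derivable_pt_lim (fun a => p1 a t) s (pd_v F2 u v / jac F1 F2 u v) /\
      derivable_pt_lim (fun b => p1 s b) t (- pd_v F1 u v / jac F1 F2 u v) /\
      derivable_pt_lim (fun a => p2 a t) s (- pd_u F2 u v / jac F1 F2 u v) /\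
      derivable_pt_lim (fun b => p2 s b) t (pd_u F1 u v / jac F1 F2 u v).
Proof.
  intros HU S1 S2 H0 HJ. pose proof (HJ u0 v0 H0) as HJ0. unfold jac in HJ0.
  set (J := pd_u F1 u0 v0 * pd_v F2 u0 v0 - pd_v F1 u0 v0 * pd_u F2 u0 v0) in HJ0.
  set (m11 := pd_v F2 u0 v0 / J). set (m12 := - pd_v F1 u0 v0 / J).
  set (m21 := - pd_u F2 u0 v0 / J). set (m22 := pd_u F1 u0 v0 / J).
  (* [id - M F], where [M] is the inverse of the differential of [F] at the centre *)
  set (E1 := fun u v => u + (- m11) * F1 u v + (- m12) * F2 u v).
  set (E2 := fun u v => v + (- m21) * F1 u v + (- m22) * F2 u v).
  assert (DE : forall (g : R -> R -> R) gu gv k1 k2,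
    (forall u v, derivable_pt_lim (fun s => g s v) u gu) ->
    (forall u v, derivable_pt_lim (fun t => g u t) v gv) ->
    (forall u v, continuity_2d_pt g u v) ->
    let E := fun u v => g u v + k1 * F1 u v + k2 * F2 u v in
    Ck 1 E U /\
    pd_u E u0 v0 = gu + k1 * pd_u F1 u0 v0 + k2 * pd_u F2 u0 v0 /\
    pd_v E u0 v0 = gv + k1 * pd_v F1 u0 v0 + k2 * pd_v F2 u0 v0).
  { intros g gu gv k1 k2 Hgu Hgv Hg E.
    assert (Sg : Ck 1 g U).
    { apply CkS_intro_Ck with (fun _ _ => gu) (fun _ _ => gv); auto using Ck_const.
      apply pt_cont2; auto. }
    assert (Sk : forall k F, Ck 1 F U -> Ck 1 (fun u v => k * F u v) U).
    { intros k F HF. apply Ck_mult; auto. now apply Ck_const. }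
    split; [repeat apply Ck_plus; auto |].
    split; [apply pd_u_eq | apply pd_v_eq]; unfold E.
    - apply (derivable_pt_lim_plus (fun s => g s v0 + k1 * F1 s v0) (fun s => k2 * F2 s v0));
      [apply (derivable_pt_lim_plus (fun s => g s v0) (fun s => k1 * F1 s v0)) |]; auto;
      [apply (derivable_pt_lim_scal (fun s => F1 s v0)) | apply (derivable_pt_lim_scal (fun s => F2 s v0))];
      apply pd_u_lim with U; auto; [apply S1 | apply S2].
    - apply (derivable_pt_lim_plus (fun t => g u0 t + k1 * F1 u0 t) (fun t => k2 * F2 u0 t));
      [apply (derivable_pt_lim_plus (fun t => g u0 t) (fun t => k1 * F1 u0 t)) |]; auto;
      [apply (derivable_pt_lim_scal (fun t => F1 u0 t)) | apply (derivable_pt_lim_scal (fun t => F2 u0 t))];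
      apply pd_v_lim with U; auto; [apply S1 | apply S2]. }
  destruct (DE (fun u _ => u) 1 0 (- m11) (- m12)) as (SE1 & E1u & E1v);
    [intros; apply derivable_pt_lim_id | intros; apply derivable_pt_lim_const
    | intros; apply continuity_2d_pt_id1 |].
  destruct (DE (fun _ v => v) 0 1 (- m21) (- m22)) as (SE2 & E2u & E2v);
    [intros; apply derivable_pt_lim_const | intros; apply derivable_pt_lim_id
    | intros; apply continuity_2d_pt_id2 |].
  fold E1 in SE1, E1u, E1v. fold E2 in SE2, E2u, E2v. clear DE.
  assert (Hzero : pd_u E1 u0 v0 = 0 /\ pd_v E1 u0 v0 = 0 /\ pd_u E2 u0 v0 = 0 /\ pd_v E2 u0 v0 = 0).
  { rewrite E1u, E1v, E2u, E2v. unfold m11, m12, m21, m22, J. unfold J in HJ0.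
    repeat split; field; exact HJ0. }
  destruct Hzero as (Z1u & Z1v & Z2u & Z2v).
  (* Two components with constant 1/4 each add up to the contraction factor 1/2. *)
  destruct (small_lipschitz E1 U u0 v0 (/ 4) HU SE1 H0 Z1u Z1v) as (r1 & Hr1 & L1); [lra |].
  destruct (small_lipschitz E2 U u0 v0 (/ 4) HU SE2 H0 Z2u Z2v) as (r2 & Hr2 & L2); [lra |].
  destruct (HU u0 v0 H0) as (r3 & Hr3 & L3).
  assert (Hr : exists r, 0 < r /\ r <= r1 /\ r <= r2 /\ r < r3).
  { exists (Rmin (Rmin r1 r2) (r3 / 2)).
    pose proof (Rmin_l (Rmin r1 r2) (r3 / 2)). pose proof (Rmin_r (Rmin r1 r2) (r3 / 2)).
    pose proof (Rmin_l r1 r2). pose proof (Rmin_r r1 r2).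
    split; [repeat apply Rmin_pos; lra | lra]. }
  destruct Hr as (r & Hr & Hrr1 & Hrr2 & Hrr3).
  set (K := Rabs m11 + Rabs m12 + Rabs m21 + Rabs m22).
  assert (HK : 0 <= K) by (unfold K; pose proof (Rabs_pos m11); pose proof (Rabs_pos m12);
    pose proof (Rabs_pos m21); pose proof (Rabs_pos m22); lra).
  assert (HM : forall s t, Rabs (m11 * s + m12 * t) + Rabs (m21 * s + m22 * t)
    <= K * (Rabs s + Rabs t)).
  { intros s t. pose proof (Rabs_triang (m11 * s) (m12 * t)) as T1.
    pose proof (Rabs_triang (m21 * s) (m22 * t)) as T2. rewrite !Rabs_mult in T1, T2.
    pose proof (Rabs_pos m11). pose proof (Rabs_pos m12).
    pose proof (Rabs_pos m21). pose proof (Rabs_pos m22).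
    pose proof (Rabs_pos s). pose proof (Rabs_pos t). unfold K. nra. }
  set (near := fun u v => Rabs (u - u0) <= r /\ Rabs (v - v0) <= r).
  (* In [q = E q + M (F q)] the part [E] accounts for at most half of the distance; moving that half
     to the left produces the factor 2. *)
  assert (Hlip : forall u v u' v', near u v -> near u' v' ->
    Rabs (u - u') + Rabs (v - v') <=
    2 * K * (Rabs (F1 u v - F1 u' v') + Rabs (F2 u v - F2 u' v'))).
  { intros u v u' v' [Hu Hv] [Hu' Hv'].
    pose proof (L1 u v u' v' ltac:(lra) ltac:(lra) ltac:(lra) ltac:(lra)) as B1.
    pose proof (L2 u v u' v' ltac:(lra) ltac:(lra) ltac:(lra) ltac:(lra)) as B2.
    pose proof (HM (F1 u v - F1 u' v') (F2 u v - F2 u' v')) as B3.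
    pose proof (Rabs_triang (E1 u v - E1 u' v')
      (m11 * (F1 u v - F1 u' v') + m12 * (F2 u v - F2 u' v'))) as T1.
    pose proof (Rabs_triang (E2 u v - E2 u' v')
      (m21 * (F1 u v - F1 u' v') + m22 * (F2 u v - F2 u' v'))) as T2.
    replace (E1 u v - E1 u' v' + (m11 * (F1 u v - F1 u' v') + m12 * (F2 u v - F2 u' v')))
      with (u - u') in T1 by (unfold E1; ring).
    replace (E2 u v - E2 u' v' + (m21 * (F1 u v - F1 u' v') + m22 * (F2 u v - F2 u' v')))
      with (v - v') in T2 by (unfold E2; ring).
    lra. }
  set (s0 := F1 u0 v0). set (t0 := F2 u0 v0).
  (* On the square [E1] and [E2] differ from their central values by at most [r / 2], and with this
     radius the shift by [M] adds at most [r / 4], so the square is mapped into itself. [K + 1]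
     keeps the divisor positive. *)
  set (rho := r / (8 * (K + 1))).
  assert (Hrho : 0 < rho) by (apply Rdiv_lt_0_compat; lra).
  assert (HKrho : K * (rho + rho) <= r / 4).
  { replace (r / 4) with ((K + 1) * (rho + rho)) by (unfold rho; field; lra). nra. }
  assert (Hex : forall s t, square s0 t0 rho s t ->
    exists q : R * R, near (fst q) (snd q) /\ F1 (fst q) (snd q) = s /\ F2 (fst q) (snd q) = t).
  { intros s t [Hs Ht].
    destruct (contraction_fixed_point (fun u v => E1 u v + (m11 * s + m12 * t))
      (fun u v => E2 u v + (m21 * s + m22 * t)) u0 v0 r Hr) as (u & v & Hu & Hv & T1 & T2).
    - intros u v Hu Hv.
      pose proof (L1 u v u0 v0 ltac:(lra) ltac:(lra)) as B1.
      pose proof (L2 u v u0 v0 ltac:(lra) ltac:(lra)) as B2.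
      rewrite !Rminus_eq_0, Rabs_R0 in B1, B2.
      specialize (B1 ltac:(lra) ltac:(lra)). specialize (B2 ltac:(lra) ltac:(lra)).
      pose proof (HM (s - s0) (t - t0)) as B3.
      assert (B4 : K * (Rabs (s - s0) + Rabs (t - t0)) <= r / 4).
      { eapply Rle_trans; [| exact HKrho]. apply Rmult_le_compat_l; lra. }
      pose proof (Rabs_triang (E1 u v - E1 u0 v0) (m11 * (s - s0) + m12 * (t - t0))) as T1.
      pose proof (Rabs_triang (E2 u v - E2 u0 v0) (m21 * (s - s0) + m22 * (t - t0))) as T2.
      pose proof (Rabs_pos (m11 * (s - s0) + m12 * (t - t0))).
      pose proof (Rabs_pos (m21 * (s - s0) + m22 * (t - t0))).
      replace (E1 u v - E1 u0 v0 + (m11 * (s - s0) + m12 * (t - t0)))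
        with (E1 u v + (m11 * s + m12 * t) - u0) in T1 by (unfold E1, s0, t0; ring).
      replace (E2 u v - E2 u0 v0 + (m21 * (s - s0) + m22 * (t - t0)))
        with (E2 u v + (m21 * s + m22 * t) - v0) in T2 by (unfold E2, s0, t0; ring).
      lra.
    - intros u v u' v' Hu Hv Hu' Hv'.
      pose proof (L1 u v u' v' ltac:(lra) ltac:(lra) ltac:(lra) ltac:(lra)) as B1.
      pose proof (L2 u v u' v' ltac:(lra) ltac:(lra) ltac:(lra) ltac:(lra)) as B2.
      replace (E1 u v + (m11 * s + m12 * t) - (E1 u' v' + (m11 * s + m12 * t)))
        with (E1 u v - E1 u' v') by ring.
      replace (E2 u v + (m21 * s + m22 * t) - (E2 u' v' + (m21 * s + m22 * t)))
        with (E2 u v - E2 u' v') by ring. lra.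
    - exists (u, v). simpl. split; [now split |].
      (* The fixed point equation says that [M] kills the residual; applying the differential at the
         centre, which inverts [M], shows that the residual is 0. *)
      assert (A1 : m11 * (s - F1 u v) + m12 * (t - F2 u v) = 0) by (unfold E1 in T1; lra).
      assert (A2 : m21 * (s - F1 u v) + m22 * (t - F2 u v) = 0) by (unfold E2 in T2; lra).
      assert (B1 : s - F1 u v = pd_u F1 u0 v0 * (m11 * (s - F1 u v) + m12 * (t - F2 u v))
        + pd_v F1 u0 v0 * (m21 * (s - F1 u v) + m22 * (t - F2 u v)))
        by (unfold m11, m12, m21, m22, J; unfold J in HJ0; field; exact HJ0).
      assert (B2 : t - F2 u v = pd_u F2 u0 v0 * (m11 * (s - F1 u v) + m12 * (t - F2 u v))
        + pd_v F2 u0 v0 * (m21 * (s - F1 u v) + m22 * (t - F2 u v)))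
        by (unfold m11, m12, m21, m22, J; unfold J in HJ0; field; exact HJ0).
      rewrite A1, A2 in B1, B2. lra. }
  set (p := fun s t => epsilon (inhabits (0, 0)) (fun q : R * R =>
    near (fst q) (snd q) /\ F1 (fst q) (snd q) = s /\ F2 (fst q) (snd q) = t)).
  assert (Hp : forall s t, square s0 t0 rho s t ->
    near (fst (p s t)) (snd (p s t)) /\ F1 (fst (p s t)) (snd (p s t)) = s /\
    F2 (fst (p s t)) (snd (p s t)) = t).
  { intros s t H. apply (epsilon_spec (inhabits (0, 0)) (fun q : R * R =>
      near (fst q) (snd q) /\ F1 (fst q) (snd q) = s /\ F2 (fst q) (snd q) = t)), Hex, H. }
  assert (Hplip : forall s t s' t', square s0 t0 rho s t -> square s0 t0 rho s' t' ->
    Rabs (fst (p s' t') - fst (p s t)) + Rabs (snd (p s' t') - snd (p s t))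
    <= 2 * K * (Rabs (s' - s) + Rabs (t' - t))).
  { intros s t s' t' H H'. destruct (Hp s t H) as (N & P1 & P2).
    destruct (Hp s' t' H') as (N' & P1' & P2').
    pose proof (Hlip _ _ _ _ N' N) as L. rewrite P1, P2, P1', P2' in L. exact L. }
  assert (Hpc : forall f : R * R -> R,
    (forall q q', Rabs (f q' - f q) <= Rabs (fst q' - fst q) + Rabs (snd q' - snd q)) ->
    cont2 (fun s t => f (p s t)) (square s0 t0 rho)).
  { intros f Hf s t H eps Heps. exists (eps / (4 * (K + 1))). split; [apply Rdiv_lt_0_compat; lra |].
    intros s' t' H' Hs Ht. eapply Rle_lt_trans; [apply Hf |].
    eapply Rle_lt_trans; [apply (Hplip s t s' t' H H') |].
    replace eps with (4 * ((K + 1) * (eps / (4 * (K + 1))))) by (field; lra).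
    assert (0 < eps / (4 * (K + 1))) by (apply Rdiv_lt_0_compat; lra).
    pose proof (Rabs_pos (s' - s)). pose proof (Rabs_pos (t' - t)). nra. }
  exists (square s0 t0 rho), (fun s t => fst (p s t)), (fun s t => snd (p s t)).
  (* The [epsilon] choice over the image of the centre must be the centre itself: by [Hlip], two
     preimages of one point in [near] are at distance 0. *)
  assert (Hcenter : fst (p s0 t0) = u0 /\ snd (p s0 t0) = v0).
  { destruct (Hp s0 t0 (square_center _ _ _ Hrho)) as (N & P1 & P2).
    assert (N0 : near u0 v0) by (split; rewrite Rminus_eq_0, Rabs_R0; lra).
    pose proof (Hlip _ _ _ _ N N0) as L. rewrite P1, P2 in L. fold s0 t0 in L.
    rewrite !Rminus_eq_0, !Rabs_R0 in L.
    split; apply Rminus_diag_uniq;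
    pose proof (Rabs_pos (fst (p s0 t0) - u0)); pose proof (Rabs_pos (snd (p s0 t0) - v0));
    match goal with |- ?a = 0 => destruct (Req_dec a 0) as [E | E]; [exact E |];
      apply Rabs_pos_lt in E; lra end. }
  destruct Hcenter as [P10 P20].
  repeat (split; [first [apply square_open | apply square_center; exact Hrho | assumption
    | apply (Hpc fst); intros q q'; pose proof (Rabs_pos (snd q' - snd q)); lra
    | apply (Hpc snd); intros q q'; pose proof (Rabs_pos (fst q' - fst q)); lra] |]).
  intros s t H. simpl. destruct (Hp s t H) as (N & P1 & P2).
  assert (HUq : U (fst (p s t)) (snd (p s t))) by (destruct N; apply L3; lra).
  destruct (open2_locally _ s t (square_open s0 t0 rho) H) as [d Hd].
  pose proof (Ck1_differentiable F1 U _ _ HU S1 HUq) as D1.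
  pose proof (Ck1_differentiable F2 U _ _ HU S2 HUq) as D2.
  assert (Hds : forall h, Rabs h < d -> square s0 t0 rho (s + h) t).
  { intros h Hh. apply Hd; [now replace (s + h - s) with h by ring |].
    rewrite Rminus_eq_0, Rabs_R0. apply cond_pos. }
  assert (Hdt : forall h, Rabs h < d -> square s0 t0 rho s (t + h)).
  { intros h Hh. apply Hd; [| now replace (t + h - t) with h by ring].
    rewrite Rminus_eq_0, Rabs_R0. apply cond_pos. }
  destruct (fun A B => derivable_inverse_curve F1 F2 (fun a => fst (p a t)) (fun a => snd (p a t))
    s 1 0 (2 * K) d _ _ _ _ (cond_pos d) A B D1 D2 (HJ _ _ HUq)) as [Ds1 Ds2].
  { intros h Hh. pose proof (Hplip _ _ _ _ H (Hds h Hh)) as L.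
    replace (s + h - s) with h in L by ring. rewrite Rminus_eq_0, Rabs_R0, Rplus_0_r in L. exact L. }
  { intros h Hh. destruct (Hp _ _ (Hds h Hh)) as (_ & P1' & P2').
    rewrite P1, P2, P1', P2'. split; ring. }
  destruct (fun A B => derivable_inverse_curve F1 F2 (fun b => fst (p s b)) (fun b => snd (p s b))
    t 0 1 (2 * K) d _ _ _ _ (cond_pos d) A B D1 D2 (HJ _ _ HUq)) as [Dt1 Dt2].
  { intros h Hh. pose proof (Hplip _ _ _ _ H (Hdt h Hh)) as L.
    replace (t + h - t) with h in L by ring. rewrite Rminus_eq_0, Rabs_R0, Rplus_0_l in L. exact L. }
  { intros h Hh. destruct (Hp _ _ (Hdt h Hh)) as (_ & P1' & P2').
    rewrite P1, P2, P1', P2'. split; ring. }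
  repeat split; try assumption; (eapply derivable_pt_lim_eq; [| eassumption]);
  unfold jac; f_equal; ring.
Qed.

(** * Vector fields *)

Definition vCk k (X : R -> R -> R4) U : Prop :=
  Ck k (fun u v => c1 (X u v)) U /\ Ck k (fun u v => c2 (X u v)) U /\
  Ck k (fun u v => c3 (X u v)) U /\ Ck k (fun u v => c4 (X u v)) U.

Lemma vsmooth_vCk X U k : vsmooth X U -> vCk k X U.
Proof. intros (H1 & H2 & H3 & H4). repeat split; auto. Qed.

Lemma vCk_pd_u k X U : vCk (S k) X U -> vCk k (vpd_u X) U.
Proof. intros (H1 & H2 & H3 & H4). repeat split; simpl; [apply H1 | apply H2 | apply H3 | apply H4]. Qed.

Lemma vCk_pd_v k X U : vCk (S k) X U -> vCk k (vpd_v X) U.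
Proof. intros (H1 & H2 & H3 & H4). repeat split; simpl; [apply H1 | apply H2 | apply H3 | apply H4]. Qed.

Lemma Ck_dot k X Y U : open2 U -> vCk k X U -> vCk k Y U ->
  Ck k (fun u v => dot (X u v) (Y u v)) U.
Proof.
  intros HU (X1 & X2 & X3 & X4) (Y1 & Y2 & Y3 & Y4). unfold dot.
  repeat (apply Ck_plus; [exact HU | |]); apply Ck_mult; auto.
Qed.

Lemma derivable_pt_lim_dot (X1 X2 X3 X4 Y1 Y2 Y3 Y4 : R -> R) s a1 a2 a3 a4 b1 b2 b3 b4 :
  derivable_pt_lim X1 s a1 -> derivable_pt_lim X2 s a2 ->
  derivable_pt_lim X3 s a3 -> derivable_pt_lim X4 s a4 ->
  derivable_pt_lim Y1 s b1 -> derivable_pt_lim Y2 s b2 ->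
  derivable_pt_lim Y3 s b3 -> derivable_pt_lim Y4 s b4 ->
  derivable_pt_lim (fun r => X1 r * Y1 r + X2 r * Y2 r + X3 r * Y3 r + X4 r * Y4 r) s
    (dot (mkR4 a1 a2 a3 a4) (mkR4 (Y1 s) (Y2 s) (Y3 s) (Y4 s)) +
     dot (mkR4 (X1 s) (X2 s) (X3 s) (X4 s)) (mkR4 b1 b2 b3 b4)).
Proof.
  intros. unfold dot; simpl.
  eapply derivable_pt_lim_eq; [|
    apply (derivable_pt_lim_plus (fun r => X1 r * Y1 r + X2 r * Y2 r + X3 r * Y3 r) (fun r => X4 r * Y4 r));
    [apply (derivable_pt_lim_plus (fun r => X1 r * Y1 r + X2 r * Y2 r) (fun r => X3 r * Y3 r));
     [apply (derivable_pt_lim_plus (fun r => X1 r * Y1 r) (fun r => X2 r * Y2 r)) |] |];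
    apply derivable_pt_lim_mult; eassumption].
  simpl; ring.
Qed.

Lemma pd_u_dot X Y U u v : open2 U -> vCk 1 X U -> vCk 1 Y U -> U u v ->
  pd_u (fun a b => dot (X a b) (Y a b)) u v =
  dot (vpd_u X u v) (Y u v) + dot (X u v) (vpd_u Y u v).
Proof.
  intros HU (X1 & X2 & X3 & X4) (Y1 & Y2 & Y3 & Y4) H. apply pd_u_eq.
  apply (derivable_pt_lim_dot
    (fun s => c1 (X s v)) (fun s => c2 (X s v)) (fun s => c3 (X s v)) (fun s => c4 (X s v))
    (fun s => c1 (Y s v)) (fun s => c2 (Y s v)) (fun s => c3 (Y s v)) (fun s => c4 (Y s v)));
  match goal with |- derivable_pt_lim (fun s => ?c (?Z s v)) _ _ =>
    apply (pd_u_lim (fun a b => c (Z a b)) U); [| exact H] end;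
  match goal with K : Ck 1 ?f U |- has_pd_u ?f U => apply K end.
Qed.

Lemma pd_v_dot X Y U u v : open2 U -> vCk 1 X U -> vCk 1 Y U -> U u v ->
  pd_v (fun a b => dot (X a b) (Y a b)) u v =
  dot (vpd_v X u v) (Y u v) + dot (X u v) (vpd_v Y u v).
Proof.
  intros HU (X1 & X2 & X3 & X4) (Y1 & Y2 & Y3 & Y4) H. apply pd_v_eq.
  apply (derivable_pt_lim_dot
    (fun t => c1 (X u t)) (fun t => c2 (X u t)) (fun t => c3 (X u t)) (fun t => c4 (X u t))
    (fun t => c1 (Y u t)) (fun t => c2 (Y u t)) (fun t => c3 (Y u t)) (fun t => c4 (Y u t)));
  match goal with |- derivable_pt_lim (fun s => ?c (?Z u s)) _ _ =>
    apply (pd_v_lim (fun a b => c (Z a b)) U); [| exact H] end;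
  match goal with K : Ck 1 ?f U |- has_pd_v ?f U => apply K end.
Qed.

Lemma pd_u_ext f g (U : R -> R -> Prop) u v : open2 U -> has_pd_u g U ->
  (forall a b, U a b -> f a b = g a b) -> U u v -> pd_u f u v = pd_u g u v.
Proof.
  intros HU Hg Hfg H. apply pd_u_eq. apply derivable_pt_lim_ext_u with g U; auto.
  - intros; symmetry; auto.
  - now apply pd_u_lim with U.
Qed.

Lemma pd_v_ext f g (U : R -> R -> Prop) u v : open2 U -> has_pd_v g U ->
  (forall a b, U a b -> f a b = g a b) -> U u v -> pd_v f u v = pd_v g u v.
Proof.
  intros HU Hg Hfg H. apply pd_v_eq. apply derivable_pt_lim_ext_v with g U; auto.
  - intros; symmetry; auto.
  - now apply pd_v_lim with U.
Qed.

Lemma pd_u_mult f g U u v : Ck 1 f U -> Ck 1 g U -> U u v ->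
  pd_u (fun a b => f a b * g a b) u v = pd_u f u v * g u v + f u v * pd_u g u v.
Proof.
  intros Hf Hg H. apply pd_u_eq.
  apply (derivable_pt_lim_mult (fun s => f s v) (fun s => g s v));
  apply pd_u_lim with U; try exact H; [apply Hf | apply Hg].
Qed.

Lemma pd_v_mult f g U u v : Ck 1 f U -> Ck 1 g U -> U u v ->
  pd_v (fun a b => f a b * g a b) u v = pd_v f u v * g u v + f u v * pd_v g u v.
Proof.
  intros Hf Hg H. apply pd_v_eq.
  apply (derivable_pt_lim_mult (fun t => f u t) (fun t => g u t));
  apply pd_v_lim with U; try exact H; [apply Hf | apply Hg].
Qed.

Lemma vpd_v_vpd_u X (U : R -> R -> Prop) u v : open2 U -> vCk 2 X U -> U u v ->
  vpd_v (vpd_u X) u v = vpd_u (vpd_v X) u v.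
Proof.
  intros HU (H1 & H2 & H3 & H4) H. unfold vpd_v at 1, vpd_u at 5.
  f_equal; simpl; eapply (fun f => pd_v_pd_u f U); eauto.
Qed.

(* The exterior derivative of the 1-form [<dX, Y>] is [<dX /\ dY>], because [ddX = 0]. *)
Lemma curl_dot f h X Y (U : R -> R -> Prop) u v :
  open2 U -> vCk 2 X U -> vCk 1 Y U ->
  (forall a b, U a b -> f a b = dot (vpd_u X a b) (Y a b)) ->
  (forall a b, U a b -> h a b = dot (vpd_v X a b) (Y a b)) ->
  U u v ->
  pd_v f u v - pd_u h u v =
  dot (vpd_u X u v) (vpd_v Y u v) - dot (vpd_v X u v) (vpd_u Y u v).
Proof.
  intros HU HX HY Hf Hh H.
  pose proof (vCk_pd_u 1 X U HX) as HXu. pose proof (vCk_pd_v 1 X U HX) as HXv.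
  rewrite (pd_v_ext f (fun a b => dot (vpd_u X a b) (Y a b)) U),
          (pd_u_ext h (fun a b => dot (vpd_v X a b) (Y a b)) U); auto;
    try apply (Ck_dot 1); auto.
  rewrite (pd_v_dot _ _ U), (pd_u_dot _ _ U), (vpd_v_vpd_u X U) by auto. ring.
Qed.

Lemma dot_vadd_l a b w : dot (vadd a b) w = dot a w + dot b w.
Proof. unfold dot, vadd; simpl; ring. Qed.
Lemma dot_vadd_r a b w : dot w (vadd a b) = dot w a + dot w b.
Proof. unfold dot, vadd; simpl; ring. Qed.
Lemma dot_vscal_l r a w : dot (vscal r a) w = r * dot a w.
Proof. unfold dot, vscal; simpl; ring. Qed.
Lemma dot_vscal_r r a w : dot w (vscal r a) = r * dot w a.
Proof. unfold dot, vscal; simpl; ring. Qed.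
Lemma dot_sym a b : dot a b = dot b a.
Proof. unfold dot; ring. Qed.

Lemma R4_ext a b : c1 a = c1 b -> c2 a = c2 b -> c3 a = c3 b -> c4 a = c4 b -> a = b.
Proof. destruct a, b; simpl; intros; subst; reflexivity. Qed.

Ltac R4_ring := apply R4_ext; unfold vadd, vscal; simpl; ring.

Ltac expand_dot E :=
  rewrite ?dot_vadd_l, ?dot_vscal_l, ?dot_vadd_r, ?dot_vscal_r in E;
  repeat match goal with O : dot ?a ?b = _ |- _ =>
    first [rewrite O in E | rewrite (dot_sym b a), O in E] end.

(** * The Codazzi equations *)

(** Cramer inversion of a change of basis. Its determinant is nonzero because its square times the
    Gram determinant of [e], [f] is that of [p], [q], which is 1. The determinant in the conclusion
    is its reciprocal. *)
Lemma orthonormal_expansion e f p q a b c d :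
  p = vadd (vscal a e) (vscal b f) -> q = vadd (vscal c e) (vscal d f) ->
  dot p p = 1 -> dot q q = 1 -> dot p q = 0 ->
  e = vadd (vscal (dot e p) p) (vscal (dot e q) q) /\
  f = vadd (vscal (dot f p) p) (vscal (dot f q) q) /\
  dot e p * dot f q - dot e q * dot f p <> 0.
Proof.
  intros Hp Hq Hpp Hqq Hpq.
  assert (Hdet : a * d - b * c <> 0).
  { intros H0.
    assert (Hm : (a * d - b * c) * (a * d - b * c) * (dot e e * dot f f - dot e f * dot e f)
                 = dot p p * dot q q - dot p q * dot p q).
    { rewrite Hp, Hq, ?dot_vadd_l, ?dot_vadd_r, ?dot_vscal_l, ?dot_vscal_r,
        ?dot_vadd_r, ?dot_vscal_r, (dot_sym f e). ring. }
    rewrite Hpp, Hqq, Hpq, H0 in Hm. lra. }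
  assert (He : e = vscal (/ (a * d - b * c)) (vadd (vscal d p) (vscal (- b) q))).
  { rewrite Hp, Hq. apply R4_ext; unfold vadd, vscal; simpl; field; exact Hdet. }
  assert (Hf : f = vscal (/ (a * d - b * c)) (vadd (vscal (- c) p) (vscal a q))).
  { rewrite Hp, Hq. apply R4_ext; unfold vadd, vscal; simpl; field; exact Hdet. }
  assert (Hep : dot e p = d / (a * d - b * c)).
  { rewrite He, dot_vscal_l, dot_vadd_l, !dot_vscal_l, Hpp, (dot_sym q p), Hpq.
    field; exact Hdet. }
  assert (Heq : dot e q = - b / (a * d - b * c)).
  { rewrite He, dot_vscal_l, dot_vadd_l, !dot_vscal_l, Hqq, Hpq. field; exact Hdet. }
  assert (Hfp : dot f p = - c / (a * d - b * c)).
  { rewrite Hf, dot_vscal_l, dot_vadd_l, !dot_vscal_l, Hpp, (dot_sym q p), Hpq.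
    field; exact Hdet. }
  assert (Hfq : dot f q = a / (a * d - b * c)).
  { rewrite Hf, dot_vscal_l, dot_vadd_l, !dot_vscal_l, Hqq, Hpq. field; exact Hdet. }
  rewrite Hep, Heq, Hfp, Hfq. repeat split.
  - rewrite He at 1. apply R4_ext; unfold vadd, vscal; simpl; field; exact Hdet.
  - rewrite Hf at 1. apply R4_ext; unfold vadd, vscal; simpl; field; exact Hdet.
  - replace (d / (a * d - b * c) * (a / (a * d - b * c)) -
      - b / (a * d - b * c) * (- c / (a * d - b * c))) with (/ (a * d - b * c))
      by (field; exact Hdet).
    now apply Rinv_neq_0_compat.
Qed.

(** [Dflat] is linear in its direction, and [tc1], [tc2] take the values 1 and 0 on [zu]; hence
    coordinate derivatives can be read off from derivatives along the frame. *)
Lemma vpd_u_Dflat z X Y T u v a b : WW z u v <> 0 ->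
  zu z u v = vadd (vscal a (X u v)) (vscal b (Y u v)) ->
  vpd_u T u v = vadd (vscal a (Dflat z X T u v)) (vscal b (Dflat z Y T u v)).
Proof.
  intros HW H.
  assert (H1 : a * tc1 z u v (X u v) + b * tc1 z u v (Y u v) = 1).
  { transitivity (tc1 z u v (zu z u v)).
    - rewrite H. unfold tc1. rewrite !dot_vadd_l, !dot_vscal_l. field; exact HW.
    - unfold tc1. change (dot (zu z u v) (zv z u v)) with (FF z u v).
      change (dot (zu z u v) (zu z u v)) with (EE z u v).
      unfold WW in *. field; exact HW. }
  assert (H2 : a * tc2 z u v (X u v) + b * tc2 z u v (Y u v) = 0).
  { transitivity (tc2 z u v (zu z u v)).
    - rewrite H. unfold tc2. rewrite !dot_vadd_l, !dot_vscal_l. field; exact HW.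
    - unfold tc2. change (dot (zu z u v) (zv z u v)) with (FF z u v).
      change (dot (zu z u v) (zu z u v)) with (EE z u v). field; exact HW. }
  transitivity (vadd
    (vscal (a * tc1 z u v (X u v) + b * tc1 z u v (Y u v)) (vpd_u T u v))
    (vscal (a * tc2 z u v (X u v) + b * tc2 z u v (Y u v)) (vpd_v T u v))).
  - rewrite H1, H2. R4_ring.
  - unfold Dflat. R4_ring.
Qed.

Lemma vpd_v_Dflat z X Y T u v a b : WW z u v <> 0 ->
  zv z u v = vadd (vscal a (X u v)) (vscal b (Y u v)) ->
  vpd_v T u v = vadd (vscal a (Dflat z X T u v)) (vscal b (Dflat z Y T u v)).
Proof.
  intros HW H.
  assert (H1 : a * tc1 z u v (X u v) + b * tc1 z u v (Y u v) = 0).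
  { transitivity (tc1 z u v (zv z u v)).
    - rewrite H. unfold tc1. rewrite !dot_vadd_l, !dot_vscal_l. field; exact HW.
    - unfold tc1. rewrite (dot_sym _ (zu z u v)).
      change (dot (zu z u v) (zv z u v)) with (FF z u v).
      change (dot (zv z u v) (zv z u v)) with (GG z u v). field; exact HW. }
  assert (H2 : a * tc2 z u v (X u v) + b * tc2 z u v (Y u v) = 1).
  { transitivity (tc2 z u v (zv z u v)).
    - rewrite H. unfold tc2. rewrite !dot_vadd_l, !dot_vscal_l. field; exact HW.
    - unfold tc2. rewrite (dot_sym _ (zu z u v)).
      change (dot (zu z u v) (zv z u v)) with (FF z u v).
      change (dot (zv z u v) (zv z u v)) with (GG z u v).
      unfold WW in *. field; exact HW. }
  transitivity (vadd
    (vscal (a * tc1 z u v (X u v) + b * tc1 z u v (Y u v)) (vpd_u T u v))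
    (vscal (a * tc2 z u v (X u v) + b * tc2 z u v (Y u v)) (vpd_v T u v))).
  - rewrite H1, H2. R4_ring.
  - unfold Dflat. R4_ring.
Qed.

(** * Structure equations of the geometric frame in the given coordinates *)

Section CanonicalForms.
Variables (z : R -> R -> R4) (U : R -> R -> Prop).
Variables (x y n1 n2 : R -> R -> R4) (nu mu g1 g2 b1 b2 : R -> R -> R).
Hypothesis Hz : regular_surface z U.
Hypothesis Hframe : geometric_frame z U x y n1 n2 nu mu g1 g2 b1 b2.

(* The coframe of [x], [y] is [omega1 = al du + ga dv], [omega2 = be du + de dv]. *)
Definition al u v := dot (zu z u v) (x u v).
Definition be u v := dot (zu z u v) (y u v).
Definition ga u v := dot (zv z u v) (x u v).
Definition de u v := dot (zv z u v) (y u v).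

Lemma coframe u v : U u v ->
  zu z u v = vadd (vscal (al u v) (x u v)) (vscal (be u v) (y u v)) /\
  zv z u v = vadd (vscal (ga u v) (x u v)) (vscal (de u v) (y u v)) /\
  al u v * de u v - be u v * ga u v <> 0.
Proof.
  intros H.
  destruct Hframe as (_ & _ & _ & _ & _ & _ & _ & _ & _ & _ & Hf).
  destruct (Hf u v H) as ((Hxx & Hyy & _ & _ & Hxy & _) & ((a & b & Hx) & _) & ((c & d & Hy) & _) & _).
  exact (orthonormal_expansion _ _ _ _ a b c d Hx Hy Hxx Hyy Hxy).
Qed.

(** [Au], [Av] are the components of the tangential connection form [g1 omega1 - g2 omega2], and
    [Bu], [Bv] those of the normal connection form [b1 omega1 + b2 omega2]. *)
Lemma frame_equations u v : U u v ->
  let Au := al u v * g1 u v - be u v * g2 u v in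
  let Av := ga u v * g1 u v - de u v * g2 u v in
  let Bu := al u v * b1 u v + be u v * b2 u v in
  let Bv := ga u v * b1 u v + de u v * b2 u v in
  vpd_u x u v = vadd (vscal Au (y u v))
    (vadd (vscal (nu u v * al u v) (n1 u v)) (vscal (mu u v * be u v) (n2 u v))) /\
  vpd_v x u v = vadd (vscal Av (y u v))
    (vadd (vscal (nu u v * ga u v) (n1 u v)) (vscal (mu u v * de u v) (n2 u v))) /\
  vpd_u y u v = vadd (vscal (- Au) (x u v))
    (vadd (vscal (- (nu u v * be u v)) (n1 u v)) (vscal (mu u v * al u v) (n2 u v))) /\
  vpd_v y u v = vadd (vscal (- Av) (x u v))
    (vadd (vscal (- (nu u v * de u v)) (n1 u v)) (vscal (mu u v * ga u v) (n2 u v))) /\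
  vpd_u n1 u v = vadd (vscal (- (nu u v * al u v)) (x u v))
    (vadd (vscal (nu u v * be u v) (y u v)) (vscal Bu (n2 u v))) /\
  vpd_v n1 u v = vadd (vscal (- (nu u v * ga u v)) (x u v))
    (vadd (vscal (nu u v * de u v) (y u v)) (vscal Bv (n2 u v))) /\
  vpd_u n2 u v = vadd (vscal (- (mu u v * be u v)) (x u v))
    (vadd (vscal (- (mu u v * al u v)) (y u v)) (vscal (- Bu) (n1 u v))) /\
  vpd_v n2 u v = vadd (vscal (- (mu u v * de u v)) (x u v))
    (vadd (vscal (- (mu u v * ga u v)) (y u v)) (vscal (- Bv) (n1 u v))).
Proof.
  intros H Au Av Bu Bv. destruct (coframe u v H) as (Hzu & Hzv & _).
  destruct Hz as (_ & _ & HW). assert (HW0 : WW z u v <> 0) by (specialize (HW u v H); lra).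
  destruct Hframe as (_ & _ & _ & _ & _ & _ & _ & _ & _ & _ & Hf).
  destruct (Hf u v H) as (_ & _ & _ & _ & _ & Dxx & Dxy & Dyx & Dyy & Dx1 & Dy1 & Dx2 & Dy2 & _).
  pose proof (fun T => vpd_u_Dflat z x y T u v _ _ HW0 Hzu) as Du.
  pose proof (fun T => vpd_v_Dflat z x y T u v _ _ HW0 Hzv) as Dv.
  rewrite !Du, !Dv, Dxx, Dxy, Dyx, Dyy, Dx1, Dy1, Dx2, Dy2.
  unfold Au, Av, Bu, Bv. repeat split; R4_ring.
Qed.

Lemma smooth_coframe : smooth al U /\ smooth be U /\ smooth ga U /\ smooth de U.
Proof.
  destruct Hz as (HU & Sz & _). destruct Hframe as (Sx & Sy & _).
  repeat split; intros k; apply Ck_dot; auto using vsmooth_vCk;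
  first [apply vCk_pd_u | apply vCk_pd_v]; auto using vsmooth_vCk.
Qed.

(** The first two equations are the structure equations for [d omega1] and [d omega2]. The other
    four come from [curl_dot] applied to the pairings of [dx] with [n1], [dn1] with [y], [dy] with
    [n2] and [dx] with [n2], which equal [nu omega1], [nu omega2], [mu omega1] and [mu omega2]. *)
Lemma codazzi u v : U u v ->
  let Au := al u v * g1 u v - be u v * g2 u v in
  let Av := ga u v * g1 u v - de u v * g2 u v in
  let Bu := al u v * b1 u v + be u v * b2 u v in
  let Bv := ga u v * b1 u v + de u v * b2 u v in
  pd_v al u v - pd_u ga u v = be u v * Av - de u v * Au /\
  pd_v be u v - pd_u de u v = - (al u v * Av - ga u v * Au) /\
  pd_v nu u v * al u v - pd_u nu u v * ga u v
    = 2 * nu u v * (de u v * Au - be u v * Av) + mu u v * (be u v * Bv - de u v * Bu) /\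
  pd_v mu u v * al u v - pd_u mu u v * ga u v
    = 2 * mu u v * (de u v * Au - be u v * Av) + nu u v * (be u v * Bv - de u v * Bu) /\
  pd_v nu u v * be u v - pd_u nu u v * de u v
    = 2 * nu u v * (al u v * Av - ga u v * Au) + mu u v * (ga u v * Bu - al u v * Bv) /\
  pd_v mu u v * be u v - pd_u mu u v * de u v
    = 2 * mu u v * (al u v * Av - ga u v * Au) + nu u v * (ga u v * Bu - al u v * Bv).
Proof.
  intros H Au Av Bu Bv.
  pose proof (frame_equations u v H) as FE. simpl in FE. fold Au Av Bu Bv in FE.
  destruct FE as (Xu & Xv & Yu & Yv & Mu & Mv & Nu & Nv).
  destruct (coframe u v H) as (Zu & Zv & _).
  destruct smooth_coframe as (Sal & Sbe & Sga & Sde).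
  destruct Hz as (HU & Sz & _).
  destruct Hframe as (Sx & Sy & S1 & S2 & Snu & Smu & _ & _ & _ & _ & Hf).
  assert (Orth : forall a b, U a b -> pos_orthonormal (x a b) (y a b) (n1 a b) (n2 a b))
    by (intros a b K; apply Hf, K).
  assert (FD : forall a b, U a b ->
    dot (vpd_u x a b) (n1 a b) = nu a b * al a b /\ dot (vpd_v x a b) (n1 a b) = nu a b * ga a b /\
    dot (vpd_u n1 a b) (y a b) = nu a b * be a b /\ dot (vpd_v n1 a b) (y a b) = nu a b * de a b /\
    dot (vpd_u y a b) (n2 a b) = mu a b * al a b /\ dot (vpd_v y a b) (n2 a b) = mu a b * ga a b /\
    dot (vpd_u x a b) (n2 a b) = mu a b * be a b /\ dot (vpd_v x a b) (n2 a b) = mu a b * de a b).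
  { intros a b K. destruct (frame_equations a b K) as (-> & -> & -> & -> & -> & -> & _).
    destruct (Orth a b K) as (Oxx & Oyy & O11 & O22 & Oxy & Ox1 & Ox2 & Oy1 & Oy2 & O12 & _).
    rewrite !dot_vadd_l, !dot_vscal_l, ?(dot_sym (n1 a b) (y a b)), ?(dot_sym (n2 a b) (y a b)),
      ?(dot_sym (n2 a b) (n1 a b)), ?Oyy, ?O11, ?O22, ?Oxy, ?Ox1, ?Ox2, ?Oy1, ?Oy2, ?O12.
    repeat split; ring. }
  assert (E1 : pd_v (fun a b => nu a b * al a b) u v - pd_u (fun a b => nu a b * ga a b) u v = _)
    by (apply (curl_dot _ _ x n1 U); auto using vsmooth_vCk; intros a b K; symmetry; apply FD, K).
  assert (E2 : pd_v (fun a b => nu a b * be a b) u v - pd_u (fun a b => nu a b * de a b) u v = _)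
    by (apply (curl_dot _ _ n1 y U); auto using vsmooth_vCk; intros a b K; symmetry; apply FD, K).
  assert (E3 : pd_v (fun a b => mu a b * al a b) u v - pd_u (fun a b => mu a b * ga a b) u v = _)
    by (apply (curl_dot _ _ y n2 U); auto using vsmooth_vCk; intros a b K; symmetry; apply FD, K).
  assert (E4 : pd_v (fun a b => mu a b * be a b) u v - pd_u (fun a b => mu a b * de a b) u v = _)
    by (apply (curl_dot _ _ x n2 U); auto using vsmooth_vCk; intros a b K; symmetry; apply FD, K).
  assert (E5 : pd_v al u v - pd_u ga u v = _)
    by (apply (curl_dot _ _ z x U); auto using vsmooth_vCk).
  assert (E6 : pd_v be u v - pd_u de u v = _)
    by (apply (curl_dot _ _ z y U); auto using vsmooth_vCk).
  clear FD.
  rewrite (pd_v_mult _ _ U), (pd_u_mult _ _ U) in E1 by auto.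
  rewrite (pd_v_mult _ _ U), (pd_u_mult _ _ U) in E2 by auto.
  rewrite (pd_v_mult _ _ U), (pd_u_mult _ _ U) in E3 by auto.
  rewrite (pd_v_mult _ _ U), (pd_u_mult _ _ U) in E4 by auto.
  change (vpd_u z u v) with (zu z u v) in E5, E6. change (vpd_v z u v) with (zv z u v) in E5, E6.
  rewrite Xu, Xv, Mu, Mv in E1. rewrite Yu, Yv, Mu, Mv in E2.
  rewrite Yu, Yv, Nu, Nv in E3. rewrite Xu, Xv, Nu, Nv in E4.
  rewrite Xu, Xv, Zu, Zv in E5. rewrite Yu, Yv, Zu, Zv in E6.
  destruct (Orth u v H) as (Oxx & Oyy & O11 & O22 & Oxy & Ox1 & Ox2 & Oy1 & Oy2 & O12 & _).
  expand_dot E1; expand_dot E2; expand_dot E3; expand_dot E4; expand_dot E5; expand_dot E6.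
  (* The structure equations remove the derivatives of the coframe, so that only those of [nu] and
     [mu] remain. *)
  assert (F5 : pd_v al u v = pd_u ga u v + (be u v * Av - de u v * Au)) by lra.
  assert (F6 : pd_v be u v = pd_u de u v - (al u v * Av - ga u v * Au)) by lra.
  rewrite F5 in E1, E3. rewrite F6 in E2, E4.
  repeat split; lra.
Qed.

(* With [L = mu^2 - nu^2], the weight is [lam = |L|^(1/4)], written without
   absolute value as [(L^2)^(1/8)]. *)
Definition LL u v := mu u v ^ 2 - nu u v ^ 2.
Definition lam u v := Rpower (LL u v * LL u v) (/ 8).

(** * The weight and closedness of the weighted coframe *)

Lemma LL_sqr_pos u v : U u v -> 0 < LL u v * LL u v.
Proof.
  intros H. destruct Hframe as (_ & _ & _ & _ & _ & _ & _ & _ & _ & _ & Hf).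
  assert (LL u v <> 0) by (unfold LL; intros E; apply (Hf u v H); lra). nra.
Qed.

Lemma smooth_LL : smooth LL U.
Proof.
  destruct Hz as (HU & _). destruct Hframe as (_ & _ & _ & _ & Snu & Smu & _).
  intros k. apply Ck_ext with (fun u v => mu u v * mu u v + - (nu u v * nu u v)); auto.
  - intros; unfold LL; ring.
  - apply Ck_plus; auto. + apply Ck_mult; auto.
    + apply Ck_opp; auto. apply Ck_mult; auto.
Qed.

Lemma smooth_lam : smooth lam U.
Proof.
  destruct Hz as (HU & _). intros k. apply (Ck_Rpower k (fun u v => LL u v * LL u v)); auto.
  - apply LL_sqr_pos.
  - apply Ck_mult; auto; apply smooth_LL.
Qed.

(** The logarithmic derivative of [|L|^(1/4)] with denominators cleared. Differentiating a power of
    [L^2] avoids a case split on the sign of [L]. *)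
Lemma pd_lam u v : U u v ->
  4 * LL u v * pd_u lam u v = lam u v * pd_u LL u v /\
  4 * LL u v * pd_v lam u v = lam u v * pd_v LL u v.
Proof.
  intros H. pose proof (LL_sqr_pos u v H) as Hp. pose proof (smooth_LL 1%nat) as SL.
  assert (HR : Rpower (LL u v * LL u v) (/ 8 - 1) * (LL u v * LL u v) = lam u v).
  { unfold lam. rewrite <- (Rpower_1 (LL u v * LL u v)) at 2 by exact Hp.
    rewrite <- Rpower_plus. f_equal. ring. }
  split.
  - rewrite (pd_u_eq lam u v (/ 8 * Rpower (LL u v * LL u v) (/ 8 - 1)
      * (pd_u LL u v * LL u v + LL u v * pd_u LL u v))).
    + rewrite <- HR. field.
    + apply (derivable_pt_lim_Rpower_comp (fun s => LL s v * LL s v)); [exact Hp |].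
      apply (derivable_pt_lim_mult (fun s => LL s v) (fun s => LL s v));
      apply pd_u_lim with U; auto; apply SL.
  - rewrite (pd_v_eq lam u v (/ 8 * Rpower (LL u v * LL u v) (/ 8 - 1)
      * (pd_v LL u v * LL u v + LL u v * pd_v LL u v))).
    + rewrite <- HR. field.
    + apply (derivable_pt_lim_Rpower_comp (fun t => LL u t * LL u t)); [exact Hp |].
      apply (derivable_pt_lim_mult (fun t => LL u t) (fun t => LL u t));
      apply pd_v_lim with U; auto; apply SL.
Qed.

Lemma pd_LL u v : U u v ->
  pd_u LL u v = 2 * mu u v * pd_u mu u v - 2 * nu u v * pd_u nu u v /\
  pd_v LL u v = 2 * mu u v * pd_v mu u v - 2 * nu u v * pd_v nu u v.
Proof.
  intros H. destruct Hframe as (_ & _ & _ & _ & Snu & Smu & _).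
  assert (D : forall f g s a b, derivable_pt_lim f s a -> derivable_pt_lim g s b ->
    derivable_pt_lim (fun r => f r ^ 2 - g r ^ 2) s (2 * f s * a - 2 * g s * b)).
  { intros f g s a b Hf Hg.
    apply (derivable_pt_lim_minus (fun r => f r ^ 2) (fun r => g r ^ 2));
    (eapply derivable_pt_lim_eq;
     [| apply (derivable_pt_lim_comp _ (fun r => r ^ 2)); [eassumption | apply derivable_pt_lim_pow]]);
    simpl; ring. }
  split; [apply pd_u_eq, (D (fun s => mu s v) (fun s => nu s v))
         | apply pd_v_eq, (D (fun t => mu u t) (fun t => nu u t))];
  (apply pd_u_lim with U || apply pd_v_lim with U); auto;
  first [apply (Smu 1%nat) | apply (Snu 1%nat)].
Qed.

(** After multiplication by [4 L], the differential of [lam] becomes [lam dL] with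
    [dL = 2 mu dmu - 2 nu dnu]. In this combination of the Codazzi equations the normal connection
    terms cancel, and the rest is the opposite of [4 L] times the curl of the coframe form. *)
Lemma canonical_forms_closed u v : U u v ->
  pd_v (fun a b => lam a b * al a b) u v = pd_u (fun a b => lam a b * ga a b) u v /\
  pd_v (fun a b => lam a b * be a b) u v = pd_u (fun a b => lam a b * de a b) u v.
Proof.
  intros H. destruct (codazzi u v H) as (C5 & C6 & C1 & C2 & C3 & C4).
  destruct smooth_coframe as (Sal & Sbe & Sga & Sde). pose proof smooth_lam as Slam.
  rewrite !(pd_v_mult _ _ U), !(pd_u_mult _ _ U) by auto.
  pose proof (LL_sqr_pos u v H) as Hp. destruct (pd_LL u v H) as (Lu & Lv).
  destruct (pd_lam u v H) as (lu & lv). rewrite Lu in lu. rewrite Lv in lv.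
  assert (HL : LL u v = mu u v ^ 2 - nu u v ^ 2) by reflexivity.
  (* The remaining identities hold for arbitrary connection components, which therefore become
     variables. *)
  revert C1 C2 C3 C4 C5 C6.
  generalize (al u v * b1 u v + be u v * b2 u v) (ga u v * b1 u v + de u v * b2 u v)
    (al u v * g1 u v - be u v * g2 u v) (ga u v * g1 u v - de u v * g2 u v).
  intros Bu Bv Au Av C1 C2 C3 C4 C5 C6.
  split; apply Rminus_diag_uniq; apply Rmult_eq_reg_l with (4 * LL u v); try nra; rewrite Rmult_0_r.
  - transitivity (lam u v * (4 * LL u v * (pd_v al u v - pd_u ga u v)
      + 2 * mu u v * (pd_v mu u v * al u v - pd_u mu u v * ga u v)
      - 2 * nu u v * (pd_v nu u v * al u v - pd_u nu u v * ga u v))).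
    + replace (4 * LL u v * (pd_v lam u v * al u v + lam u v * pd_v al u v -
        (pd_u lam u v * ga u v + lam u v * pd_u ga u v)))
      with (4 * LL u v * pd_v lam u v * al u v - 4 * LL u v * pd_u lam u v * ga u v
        + lam u v * (4 * LL u v * (pd_v al u v - pd_u ga u v))) by ring.
      rewrite lu, lv. ring.
    + rewrite C1, C2, C5, HL. ring.
  - transitivity (lam u v * (4 * LL u v * (pd_v be u v - pd_u de u v)
      + 2 * mu u v * (pd_v mu u v * be u v - pd_u mu u v * de u v)
      - 2 * nu u v * (pd_v nu u v * be u v - pd_u nu u v * de u v))).
    + replace (4 * LL u v * (pd_v lam u v * be u v + lam u v * pd_v be u v -
        (pd_u lam u v * de u v + lam u v * pd_u de u v)))
      with (4 * LL u v * pd_v lam u v * be u v - 4 * LL u v * pd_u lam u v * de u v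
        + lam u v * (4 * LL u v * (pd_v be u v - pd_u de u v))) by ring.
      rewrite lu, lv. ring.
    + rewrite C3, C4, C6, HL. ring.
Qed.

Lemma lam_pos u v : 0 < lam u v.
Proof. apply exp_pos. Qed.

(** [|L|] is the square root of [L^2], so [sqrt |L|] is the power 1/4 of [L^2], twice the exponent
    1/8 of [lam]. *)
Lemma lam_sqr u v : U u v -> lam u v * lam u v = sqrt (Rabs (mu u v ^ 2 - nu u v ^ 2)).
Proof.
  intros H. pose proof (LL_sqr_pos u v H) as Hp. fold (LL u v).
  rewrite <- sqrt_Rsqr_abs. unfold Rsqr.
  rewrite <- (Rpower_sqrt (LL u v * LL u v)) by exact Hp.
  rewrite <- Rpower_sqrt by apply exp_pos.
  rewrite Rpower_mult. unfold lam. rewrite <- Rpower_plus. f_equal. field.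
Qed.

(** With potentials [dP = lam omega1] and [dQ = lam omega2], the coordinate fields of the parameters
    [(P, Q)] are the frame dual to these forms, that is [x / lam] and [y / lam]. *)
Lemma canonical_parameters u0 v0 : U u0 v0 ->
  exists (V : R -> R -> Prop) (p1 p2 : R -> R -> R),
    local_reparam U u0 v0 V p1 p2 /\
    forall s t, V s t ->
      zu (reparam z p1 p2) s t = vscal (/ lam (p1 s t) (p2 s t)) (x (p1 s t) (p2 s t)) /\
      zv (reparam z p1 p2) s t = vscal (/ lam (p1 s t) (p2 s t)) (y (p1 s t) (p2 s t)).
Proof.
  intros H0. destruct Hz as (HU & Sz & _).
  destruct smooth_coframe as (Sal & Sbe & Sga & Sde). pose proof smooth_lam as Slam.
  assert (Sl : forall f, smooth f U -> smooth (fun a b => lam a b * f a b) U)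
    by (intros f Hf k; apply Ck_mult; auto).
  destruct (poincare (fun a b => lam a b * al a b) (fun a b => lam a b * ga a b) U u0 v0)
    as (P & r1 & Hr1 & HP); auto; [apply Sl, Sal | apply Sl, Sga | apply canonical_forms_closed |].
  destruct (poincare (fun a b => lam a b * be a b) (fun a b => lam a b * de a b) U u0 v0)
    as (Q & r2 & Hr2 & HQ); auto; [apply Sl, Sbe | apply Sl, Sde | apply canonical_forms_closed |].
  set (r := Rmin r1 r2). assert (Hr : 0 < r) by now apply Rmin_pos.
  assert (HS1 : forall u v, square u0 v0 r u v -> square u0 v0 r1 u v)
    by (intros u v [K1 K2]; pose proof (Rmin_l r1 r2); unfold r in *; split; lra).
  assert (HS2 : forall u v, square u0 v0 r u v -> square u0 v0 r2 u v)
    by (intros u v [K1 K2]; pose proof (Rmin_r r1 r2); unfold r in *; split; lra).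
  assert (HSU : forall u v, square u0 v0 r u v -> U u v) by (intros u v K; apply HP, HS1, K).
  assert (SlS : forall f, smooth f U -> cont2 (fun a b => lam a b * f a b) (square u0 v0 r))
    by (intros f Hf; apply (Ck_subset 0 _ U); auto; apply Sl, Hf).
  assert (SP : Ck 1 P (square u0 v0 r)).
  { apply Ck1_intro with (fun a b => lam a b * al a b) (fun a b => lam a b * ga a b); auto;
    [apply square_open | |]; intros a b K; apply HP, HS1, K. }
  assert (SQ : Ck 1 Q (square u0 v0 r)).
  { apply Ck1_intro with (fun a b => lam a b * be a b) (fun a b => lam a b * de a b); auto;
    [apply square_open | |]; intros a b K; apply HQ, HS2, K. }
  assert (HPQ : forall u v, square u0 v0 r u v ->
    pd_u P u v = lam u v * al u v /\ pd_v P u v = lam u v * ga u v /\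
    pd_u Q u v = lam u v * be u v /\ pd_v Q u v = lam u v * de u v).
  { intros u v K. repeat split; (apply pd_u_eq || apply pd_v_eq);
    (apply (HP u v (HS1 u v K)) || apply (HQ u v (HS2 u v K))). }
  (* The Jacobian of [(P, Q)] is [lam * w]: one factor [lam] cancels against the numerators in the
     partials of the inverse. Writing the difference as a sum with an opposite suits [Ck_plus] and
     [Ck_opp]. *)
  set (w := fun u v => lam u v * (al u v * de u v + - (be u v * ga u v))).
  assert (Hw : forall u v, U u v -> w u v <> 0).
  { intros u v K. unfold w. apply Rmult_integral_contrapositive_currified.
    - pose proof (lam_pos u v); lra.
    - apply (coframe u v K). }
  assert (Hjac : forall u v, square u0 v0 r u v -> jac P Q u v = lam u v * w u v).
  { intros u v K. unfold jac. destruct (HPQ u v K) as (-> & -> & -> & ->). unfold w. ring. }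
  destruct (inverse_function P Q (square u0 v0 r) u0 v0) as
    (V & p1 & p2 & HV & Cp1 & Cp2 & HV0 & P10 & P20 & Hinv); auto;
    [apply square_open | now apply square_center | |].
  { intros u v K. rewrite Hjac by exact K. apply Rmult_integral_contrapositive_currified; auto.
    pose proof (lam_pos u v); lra. }
  assert (Hmap : forall s t, V s t -> U (p1 s t) (p2 s t)) by (intros s t K; apply HSU, Hinv, K).
  assert (Dp : forall s t, V s t -> let u := p1 s t in let v := p2 s t in
    derivable_pt_lim (fun a => p1 a t) s (de u v * / w u v) /\
    derivable_pt_lim (fun b => p1 s b) t (- ga u v * / w u v) /\
    derivable_pt_lim (fun a => p2 a t) s (- be u v * / w u v) /\
    derivable_pt_lim (fun b => p2 s b) t (al u v * / w u v)).
  { intros s t K. simpl. destruct (Hinv s t K) as (K1 & _ & _ & D1 & D2 & D3 & D4).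
    pose proof (Hw _ _ (HSU _ _ K1)) as Hw'. pose proof (lam_pos (p1 s t) (p2 s t)) as Hl.
    rewrite Hjac in D1, D2, D3, D4 by exact K1.
    destruct (HPQ _ _ K1) as (E1 & E2 & E3 & E4). rewrite E1 in D4. rewrite E2 in D2.
    rewrite E3 in D3. rewrite E4 in D1.
    repeat split; (eapply derivable_pt_lim_eq; [| eassumption]); field; lra. }
  assert (Sw : smooth (fun u v => / w u v) U).
  { intros k. apply Ck_inv; auto. apply (Sl (fun u v => al u v * de u v + - (be u v * ga u v))).
    intros k'. apply Ck_plus; [auto | now apply Ck_mult |].
    apply Ck_opp; [auto | now apply Ck_mult]. }
  (* By [Dp] the partials of [p1] and [p2] are functions smooth on [U], evaluated at [(p1, p2)], so
     continuity bootstraps to every order. *)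
  assert (Sp : forall k, Ck k p1 V /\ Ck k p2 V).
  { apply (Ck_bootstrap U V p1 p2 HU HV Hmap
      (fun u v => de u v * / w u v) (fun u v => - ga u v * / w u v)
      (fun u v => - be u v * / w u v) (fun u v => al u v * / w u v)); auto;
    try (intros k; apply Ck_mult; auto; now apply Ck_opp);
    intros s t K; apply Dp, K. }
  exists V, p1, p2. split.
  - split; [exact HV |]. split; [intros k; apply Sp |]. split; [intros k; apply Sp |].
    split; [exact Hmap |]. split; [| split].
    (* [(P, Q)] is a left inverse of [(p1, p2)], whence injectivity. *)
    + intros s t s' t' K K' E1 E2.
      destruct (Hinv s t K) as (_ & F1 & F2 & _). destruct (Hinv s' t' K') as (_ & F1' & F2' & _).
      rewrite E1, E2 in F1, F2. split; congruence.
    + intros s t K. destruct (Dp s t K) as (D1 & D2 & D3 & D4).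
      rewrite (pd_u_eq _ _ _ _ D1), (pd_v_eq _ _ _ _ D2), (pd_u_eq _ _ _ _ D3), (pd_v_eq _ _ _ _ D4).
      pose proof (Hw _ _ (Hmap s t K)) as Hw'.
      destruct (coframe _ _ (Hmap s t K)) as (_ & _ & HD).
      set (u := p1 s t) in *. set (v := p2 s t) in *.
      replace (de u v * / w u v * (al u v * / w u v) - - ga u v * / w u v * (- be u v * / w u v))
        with ((al u v * de u v - be u v * ga u v) * (/ w u v * / w u v)) by ring.
      repeat apply Rmult_integral_contrapositive_currified; auto using Rinv_neq_0_compat.
    + exists (P u0 v0), (Q u0 v0). auto.
  - intros s t K. destruct (Dp s t K) as (D1 & D2 & D3 & D4).
    destruct (coframe _ _ (Hmap s t K)) as (Zu & Zv & HD).
    pose proof (lam_pos (p1 s t) (p2 s t)) as Hl.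
    destruct Sz as (S1 & S2 & S3 & S4).
    assert (Cu : forall c : R4 -> R, smooth (fun u v => c (z u v)) U ->
      pd_u (fun a b => c (z (p1 a b) (p2 a b))) s t = _)
      by (intros c Hc; exact (pd_u_eq _ _ _ _
        (derivable_pt_lim_comp_u U V p1 p2 HU Hmap _ s t _ _ (Hc 1%nat) K D1 D3))).
    assert (Cv : forall c : R4 -> R, smooth (fun u v => c (z u v)) U ->
      pd_v (fun a b => c (z (p1 a b) (p2 a b))) s t = _)
      by (intros c Hc; exact (pd_v_eq _ _ _ _
        (derivable_pt_lim_comp_v U V p1 p2 HU Hmap _ s t _ _ (Hc 1%nat) K D2 D4))).
    split.
    (* In [de z_u - be z_v] the [y] components cancel and [x] keeps the coframe determinant as
       coefficient; dividing by [w] leaves [1 / lam]. *)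
    + transitivity (vadd
        (vscal (de (p1 s t) (p2 s t) * / w (p1 s t) (p2 s t)) (zu z (p1 s t) (p2 s t)))
        (vscal (- be (p1 s t) (p2 s t) * / w (p1 s t) (p2 s t)) (zv z (p1 s t) (p2 s t)))).
      * unfold zu, vpd_u, reparam. rewrite (Cu c1 S1), (Cu c2 S2), (Cu c3 S3), (Cu c4 S4).
        R4_ring.
      * rewrite Zu, Zv. unfold w. apply R4_ext; unfold vadd, vscal; simpl; field; lra.
    + transitivity (vadd
        (vscal (- ga (p1 s t) (p2 s t) * / w (p1 s t) (p2 s t)) (zu z (p1 s t) (p2 s t)))
        (vscal (al (p1 s t) (p2 s t) * / w (p1 s t) (p2 s t)) (zv z (p1 s t) (p2 s t)))).
      * unfold zv, vpd_v, reparam. rewrite (Cv c1 S1), (Cv c2 S2), (Cv c3 S3), (Cv c4 S4).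
        R4_ring.
      * rewrite Zu, Zv. unfold w. apply R4_ext; unfold vadd, vscal; simpl; field; lra.
Qed.
End CanonicalForms.

(** * The first fundamental form in the new parameters *)

Theorem theorem6p3 :
  forall (z : R -> R -> R4) (U : R -> R -> Prop)
         (x y n1 n2 : R -> R -> R4) (nu mu g1 g2 b1 b2 : R -> R -> R),
    regular_surface z U ->
    minimal z U ->
    general_type z U ->
    geometric_frame z U x y n1 n2 nu mu g1 g2 b1 b2 ->
    strongly_regular U g1 g2 ->
    forall u0 v0, U u0 v0 ->
    exists (V : R -> R -> Prop) (p1 p2 : R -> R -> R),
      local_reparam U u0 v0 V p1 p2 /\
      semi_canonical z V p1 p2 x y /\
      (forall s t, V s t ->
         EE (reparam z p1 p2) s t = / sqrt (Rabs (mu (p1 s t) (p2 s t) ^ 2 - nu (p1 s t) (p2 s t) ^ 2)) /\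
         GG (reparam z p1 p2) s t = / sqrt (Rabs (mu (p1 s t) (p2 s t) ^ 2 - nu (p1 s t) (p2 s t) ^ 2))).
Proof.
  intros z U x y n1 n2 nu mu g1 g2 b1 b2 Hz _ _ Hframe _ u0 v0 H0.
  destruct (canonical_parameters z U x y n1 n2 nu mu g1 g2 b1 b2 Hz Hframe u0 v0 H0)
    as (V & p1 & p2 & HV & Hw).
  exists V, p1, p2. split; [exact HV |].
  assert (Hfund : forall s t, V s t ->
    let l := lam nu mu (p1 s t) (p2 s t) in
    EE (reparam z p1 p2) s t = / l * / l /\ GG (reparam z p1 p2) s t = / l * / l /\
    FF (reparam z p1 p2) s t = 0 /\ 0 < l /\
    l * l = sqrt (Rabs (mu (p1 s t) (p2 s t) ^ 2 - nu (p1 s t) (p2 s t) ^ 2))).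
  { intros s t K. assert (HU : U (p1 s t) (p2 s t)) by now apply HV.
    unfold EE, GG, FF. destruct (Hw s t K) as (-> & ->).
    pose proof Hframe as (_ & _ & _ & _ & _ & _ & _ & _ & _ & _ & Hf).
    destruct (Hf _ _ HU) as ((Hxx & Hyy & _ & _ & Hxy & _) & _).
    rewrite !dot_vscal_l, !dot_vscal_r, Hxx, Hyy, Hxy. simpl.
    rewrite (lam_sqr z U x y n1 n2 nu mu g1 g2 b1 b2) by assumption.
    repeat split; try ring. apply lam_pos. }
  split.
  - intros s t K. destruct (Hfund s t K) as (HE & HG & HF & Hl & _).
    split; [exact HF |]. rewrite HE, HG. destruct (Hw s t K) as (-> & ->).
    (* Positivity of [lam] gives [sqrt E = sqrt G = 1 / lam], so normalising the coordinate fields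
       returns [x] and [y] with the right sign. *)
    rewrite sqrt_square by (apply Rlt_le, Rinv_0_lt_compat, Hl).
    split; apply R4_ext; unfold vscal; simpl; field; lra.
  - intros s t K. destruct (Hfund s t K) as (HE & HG & _ & Hl & <-).
    rewrite HE, HG. split; field; lra.
Qed.
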